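(* Let $A$ be a $C^*$-algebra and let $\psi$ be a densely defined weight on $A$. Then there is a group homomorphism $\psi_* : K_{00}(A) \to \mathbb R$ such that $$\psi_*([e]-[f]) = \underline{\psi}(e) - \underline{\psi}(f)$$ for all $e,f \in P_\infty(A)$.
   Context: Let $A$ be a $C^*$-algebra with positive cone $A^+$. A weight on $A$ is a map $\psi : A^+ \to [0,\infty]$ with $\psi(a+b)=\psi(a)+\psi(b)$ and $\psi(ta)=t\psi(a)$ for all $a,b\in A^+$ and all real $t\ge 0$, with the convention $0\cdot\infty=0$. It is densely defined when $\{a\in A^+ : \psi(a)<\infty\}$ is dense in $A^+$. No lower semi-continuity is assumed. $M_k(A)$ is the $C^*$-algebra of $k\times k$ matrices over $A$, and $P_k(A)$ is the set of projections in $M_k(A)$. $M_k(A)$ is embedded in $M_{k+1}(A)$ by adding a zero row and a zero column; $M_\infty(A)=\bigcup_k M_k(A)$ and $P_\infty(A)=\bigcup_k P_k(A)$. For $p,q\in P_\infty(A)$, $p\sim q$ means that there is $v\in M_\infty(A)$ with $vv^*=p$ and $v^*v=q$; $[e]$ denotes the class of $e$. The set $V(A)=P_\infty(A)/\sim$ is an abelian semigroup under $[p]+[q]:=[p'+q]$, where $p'\in P_\infty(A)$ is any projection with $p'\sim p$ and $p'q=0$. $K_{00}(A)$ is the Grothendieck group of $V(A)$, and $[e]$ also denotes the image in $K_{00}(A)$ of the class of $e$. For $k\in\mathbb N$, the weight $\psi_k$ on $M_k(A)$ is defined by $\psi_k(x)=\sum_{i=1}^k\psi(x_{ii})$ for $x=(x_{ij})\in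 M_k(A)^+$. These are compatible with the embeddings and give a map $\psi_\infty:P_\infty(A)\to[0,\infty]$ whose restriction to $P_k(A)$ is $\psi_k$. For $e\in P_\infty(A)$, $\underline{\psi}(e):=\inf\{\psi_\infty(f): f\in P_\infty(A),\ f\sim e\}$. *)

(* Defs.v *)
From HB Require Import structures.
From mathcomp Require Import all_boot all_order all_algebra.
From mathcomp Require Import complex.
From mathcomp Require Import boolp classical_sets reals ereal topology normedtype.

Set Implicit Arguments.
Unset Strict Implicit.
Unset Printing Implicit Defensive.

Import Order.TTheory GRing.Theory Num.Theory.
Import numFieldNormedType.Exports.

Local Open Scope classical_set_scope.
Local Open Scope ring_scope.
Local Open Scope quotient_scope.

(* C*-algebras need not be unital, hence a bare product on a complex Banach
   space instead of the (unital) rings of the hierarchy. The norm takes its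
   values in the nonnegative reals of R[i]. *)
HB.mixin Record CompleteNormedModule_isCStarAlgebra (R : realType) A
    of CompleteNormedModule R[i] A := {
  cmul : A -> A -> A;
  cstar : A -> A;
  cmulA : associative cmul;
  cmulDl : left_distributive cmul +%R;
  cmulDr : right_distributive cmul +%R;
  cmulZl : forall (c : R[i]) x y, cmul (c *: x) y = c *: cmul x y;
  cmulZr : forall (c : R[i]) x y, cmul x (c *: y) = c *: cmul x y;
  cstarK : involutive cstar;
  cstarD : {morph cstar : x y / x + y};
  cstarZ : forall (c : R[i]) x, cstar (c *: x) = c^* *: cstar x;
  cstarM : forall x y, cstar (cmul x y) = cmul (cstar y) (cstar x);
  norm_cmul : forall x y, `|cmul x y| <= `|x| * `|y|;
  norm_cstar_mul : forall x, `|cmul (cstar x) x| = `|x| ^+ 2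
}.

#[short(type="cstarAlgType")]
HB.structure Definition CStarAlgebra (R : realType) :=
  {A of CompleteNormedModule_isCStarAlgebra R A & CompleteNormedModule R[i] A}.

Section BasicFacts.
Context {R : realType} {A : cstarAlgType R}.

Lemma cmul0l (x : A) : cmul 0 x = 0.
Proof. by apply: (addrI (cmul 0 x)); rewrite -cmulDl !addr0. Qed.

Lemma cmul0r (x : A) : cmul x 0 = 0.
Proof. by apply: (addrI (cmul x 0)); rewrite -cmulDr !addr0. Qed.

Lemma cstar0 : cstar (0 : A) = 0.
Proof. by apply: (addrI (cstar 0)); rewrite -cstarD !addr0. Qed.

End BasicFacts.

Section Weights.
Context {R : realType} {A : cstarAlgType R}.

(* The pair (a, l) stands for a + l1 in the unitization of A. *)
Definition unitization_mul (x y : A * R[i]) : A * R[i] :=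
  (cmul x.1 y.1 + y.2 *: x.1 + x.2 *: y.1, x.2 * y.2).

(* Spectrum relative to the unitization; when A is unital this differs from the
   spectrum relative to A at most by the point 0. *)
Definition spectrum (a : A) : set R[i] :=
  [set l | ~ exists y, unitization_mul (a, - l) y = (0, 1) /\
                       unitization_mul y (a, - l) = (0, 1)].

(* In R[i], 0 <= l means that l is real and nonnegative. *)
Definition positive_cone : set A :=
  [set a | cstar a = a /\ spectrum a `<=` [set l | 0 <= l]].

(* Only the values on the positive cone are meaningful; note 0 * +oo = 0. *)
Record weight (psi : A -> \bar R) : Prop := Weight {
  weight_ge0 : forall a, positive_cone a -> (0 <= psi a)%E;
  weightD : forall a b, positive_cone a -> positive_cone b ->
    psi (a + b) = (psi a + psi b)%E;
  weightZ : forall (t : R) a, 0 <= t -> positive_cone a ->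
    psi (real_complex R t *: a) = (t%:E * psi a)%E
}.

Definition densely_defined (psi : A -> \bar R) : Prop :=
  positive_cone `<=` closure [set a | positive_cone a /\ (psi a < +oo)%E].

Lemma positive_cone0 : positive_cone 0.
Proof.
split; first exact: cstar0.
move=> l lP; have [-> //=|l0] := eqVneq l 0.
case: lP; exists (0, - l^-1).
by rewrite /unitization_mul /= cmul0l !scaler0 !addr0 !mulrNN mulVf // divff.
Qed.

Lemma weight0 (psi : A -> \bar R) : weight psi -> psi 0 = 0%E.
Proof.
move=> wpsi; have := weightZ wpsi (lexx 0) positive_cone0.
by rewrite scaler0 mul0e.
Qed.

End Weights.

Section Matrices.
Context {R : realType} {A : cstarAlgType R}.

Definition mxcmul m n p (x : 'M[A]_(m, n)) (y : 'M[A]_(n, p)) : 'M[A]_(m, p) :=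
  \matrix_(i, j) \sum_l cmul (x i l) (y l j).

Definition mxcstar m n (x : 'M[A]_(m, n)) : 'M[A]_(n, m) := map_mx cstar x^T.

Definition mxproj k (p : 'M[A]_k) : bool :=
  (mxcmul p p == p) && (mxcstar p == p).

Definition mxentry m n (x : 'M[A]_(m, n)) (i j : nat) : A :=
  if insub i is Some i' then if insub j is Some j' then x i' j' else 0 else 0.

(* For k <= n and l <= m, the embedding adding zero rows and columns. *)
Definition mxpad n m k l (x : 'M[A]_(k, l)) : 'M[A]_(n, m) :=
  \matrix_(i, j) mxentry x i j.

Lemma cmul_suml (x : A) I r (P : pred I) F :
  cmul (\sum_(i <- r | P i) F i) x = \sum_(i <- r | P i) cmul (F i) x.
Proof.
exact: (big_morph (fun y => cmul y x) (fun a b => cmulDl a b x) (cmul0l x)).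
Qed.

Lemma cmul_sumr (x : A) I r (P : pred I) F :
  cmul x (\sum_(i <- r | P i) F i) = \sum_(i <- r | P i) cmul x (F i).
Proof. exact: (big_morph (cmul x) (cmulDr x) (cmul0r x)). Qed.

Lemma cstar_sum I r (P : pred I) (F : I -> A) :
  cstar (\sum_(i <- r | P i) F i) = \sum_(i <- r | P i) cstar (F i).
Proof. exact: (big_morph (@cstar R A) cstarD cstar0). Qed.

Lemma mxcmulA m n p q (x : 'M[A]_(m, n)) (y : 'M[A]_(n, p)) (z : 'M[A]_(p, q)) :
  mxcmul x (mxcmul y z) = mxcmul (mxcmul x y) z.
Proof.
apply/matrixP => i j; rewrite !mxE.
transitivity (\sum_l \sum_h cmul (cmul (x i l) (y l h)) (z h j)).
  apply: eq_bigr => l _; rewrite mxE cmul_sumr.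
  by apply: eq_bigr => h _; rewrite cmulA.
by rewrite exchange_big; apply: eq_bigr => h _; rewrite mxE cmul_suml.
Qed.

Lemma mxcstarK m n (x : 'M[A]_(m, n)) : mxcstar (mxcstar x) = x.
Proof. by apply/matrixP => i j; rewrite !mxE cstarK. Qed.

Lemma mxcstarM m n p (x : 'M[A]_(m, n)) (y : 'M[A]_(n, p)) :
  mxcstar (mxcmul x y) = mxcmul (mxcstar y) (mxcstar x).
Proof.
apply/matrixP => i j; rewrite !mxE cstar_sum.
by apply: eq_bigr => l _; rewrite !mxE cstarM.
Qed.

Lemma mxcmul0l m n p (y : 'M[A]_(n, p)) : mxcmul (0 : 'M_(m, n)) y = 0.
Proof.
by apply/matrixP => i j; rewrite !mxE big1 // => l _; rewrite mxE cmul0l.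
Qed.

Lemma mxcmul0r m n p (x : 'M[A]_(m, n)) : mxcmul x (0 : 'M_(n, p)) = 0.
Proof.
by apply/matrixP => i j; rewrite !mxE big1 // => l _; rewrite mxE cmul0r.
Qed.

Lemma mxcmulDl m n p (x y : 'M[A]_(m, n)) (z : 'M[A]_(n, p)) :
  mxcmul (x + y) z = mxcmul x z + mxcmul y z.
Proof.
apply/matrixP => i j; rewrite !mxE -big_split.
by apply: eq_bigr => l _; rewrite mxE cmulDl.
Qed.

Lemma mxcmulDr m n p (x : 'M[A]_(m, n)) (y z : 'M[A]_(n, p)) :
  mxcmul x (y + z) = mxcmul x y + mxcmul x z.
Proof.
apply/matrixP => i j; rewrite !mxE -big_split.
by apply: eq_bigr => l _; rewrite mxE cmulDr.
Qed.

Lemma mxcstarD m n (x y : 'M[A]_(m, n)) : mxcstar (x + y) = mxcstar x + mxcstar y.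
Proof. by apply/matrixP => i j; rewrite !mxE cstarD. Qed.

Lemma mxcstar0 m n : mxcstar (0 : 'M[A]_(m, n)) = 0.
Proof. by apply/matrixP => i j; rewrite !mxE cstar0. Qed.

Lemma mxcmul_row_col m n1 n2 p (x : 'M[A]_(m, n1)) (y : 'M[A]_(m, n2))
    (z : 'M[A]_(n1, p)) (t : 'M[A]_(n2, p)) :
  mxcmul (row_mx x y) (col_mx z t) = mxcmul x z + mxcmul y t.
Proof.
apply/matrixP => i j; rewrite !mxE big_split_ord /=.
by congr (_ + _); apply: eq_bigr => l _;
  rewrite ?(row_mxEl, col_mxEu, row_mxEr, col_mxEd).
Qed.

Lemma mxcmul_col_row m1 m2 n p1 p2 (x : 'M[A]_(m1, n)) (y : 'M[A]_(m2, n))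
    (z : 'M[A]_(n, p1)) (t : 'M[A]_(n, p2)) :
  mxcmul (col_mx x y) (row_mx z t) =
  block_mx (mxcmul x z) (mxcmul x t) (mxcmul y z) (mxcmul y t).
Proof.
apply/matrixP => i j; rewrite -(splitK i) -(splitK j).
by case: (split i) => i'; case: (split j) => j' /=;
  rewrite ?(block_mxEul, block_mxEur, block_mxEdl, block_mxEdr) !mxE;
  apply: eq_bigr => l _;
  rewrite ?(row_mxEl, col_mxEu, row_mxEr, col_mxEd).
Qed.

Lemma mxcmul_block m1 m2 n1 n2 p1 p2
    (x11 : 'M[A]_(m1, n1)) (x12 : 'M[A]_(m1, n2))
    (x21 : 'M[A]_(m2, n1)) (x22 : 'M[A]_(m2, n2))
    (y11 : 'M[A]_(n1, p1)) (y12 : 'M[A]_(n1, p2))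
    (y21 : 'M[A]_(n2, p1)) (y22 : 'M[A]_(n2, p2)) :
  mxcmul (block_mx x11 x12 x21 x22) (block_mx y11 y12 y21 y22) =
  block_mx (mxcmul x11 y11 + mxcmul x12 y21) (mxcmul x11 y12 + mxcmul x12 y22)
           (mxcmul x21 y11 + mxcmul x22 y21) (mxcmul x21 y12 + mxcmul x22 y22).
Proof.
apply/matrixP => i j; rewrite -(splitK i) -(splitK j).
by case: (split i) => i'; case: (split j) => j' /=;
  rewrite ?(block_mxEul, block_mxEur, block_mxEdl, block_mxEdr) !mxE
    big_split_ord /=; congr (_ + _); apply: eq_bigr => l _;
  rewrite ?(block_mxEul, block_mxEur, block_mxEdl, block_mxEdr).
Qed.

Lemma mxcstar_block m1 m2 n1 n2
    (x11 : 'M[A]_(m1, n1)) (x12 : 'M[A]_(m1, n2))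
    (x21 : 'M[A]_(m2, n1)) (x22 : 'M[A]_(m2, n2)) :
  mxcstar (block_mx x11 x12 x21 x22) =
  block_mx (mxcstar x11) (mxcstar x21) (mxcstar x12) (mxcstar x22).
Proof. by rewrite /mxcstar tr_block_mx map_block_mx. Qed.

Lemma mxcstar_col m1 m2 n (x : 'M[A]_(m1, n)) (y : 'M[A]_(m2, n)) :
  mxcstar (col_mx x y) = row_mx (mxcstar x) (mxcstar y).
Proof. by rewrite /mxcstar tr_col_mx map_row_mx. Qed.

Lemma mxentryE m n (x : 'M[A]_(m, n)) (i : 'I_m) (j : 'I_n) :
  mxentry x i j = x i j.
Proof. by rewrite /mxentry !valK. Qed.

Lemma mxentry_out m n (x : 'M[A]_(m, n)) i j :
  ~~ ((i < m) && (j < n))%N -> mxentry x i j = 0.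
Proof.
rewrite /mxentry; case: insubP => // i' lti _; case: insubP => // j' ltj _.
by rewrite lti ltj.
Qed.

Lemma mxentryM m n p (x : 'M[A]_(m, n)) (y : 'M[A]_(n, p)) N i j :
  (n <= N)%N ->
  mxentry (mxcmul x y) i j = \sum_(l < N) cmul (mxentry x i l) (mxentry y l j).
Proof.
move=> nN; have [/andP[im jp]|ij] := boolP ((i < m) && (j < p))%N; last first.
  rewrite mxentry_out // big1 // => l _; move: ij; rewrite negb_and.
  case/orP => h.
    by rewrite (@mxentry_out _ _ x) ?negb_and ?h // cmul0l.
  by rewrite (@mxentry_out _ _ y) ?negb_and ?h ?orbT // cmul0r.
rewrite (_ : i = Ordinal im) // (_ : j = Ordinal jp) // mxentryE mxE.
rewrite (eq_bigr (fun l : 'I_n => cmul (mxentry x (Ordinal im) l)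
  (mxentry y l (Ordinal jp)))); last by move=> l _; rewrite !mxentryE.
rewrite (big_ord_widen N
  (fun l => cmul (mxentry x (Ordinal im) l) (mxentry y l (Ordinal jp)))) //.
rewrite big_mkcond; apply: eq_bigr => l _; case: ltnP => // nl.
by rewrite (@mxentry_out _ _ x) ?cmul0l // negb_and -!leqNgt nl orbT.
Qed.

Lemma mxpadM m n p m' n' p' (x : 'M[A]_(m, n)) (y : 'M[A]_(n, p)) :
  (n <= n')%N ->
  mxpad m' p' (mxcmul x y) = mxcmul (mxpad m' n' x) (mxpad n' p' y).
Proof.
move=> nn'; apply/matrixP => i j; rewrite !mxE (mxentryM _ _ _ _ nn').
by apply: eq_bigr => l _; rewrite !mxE.
Qed.

Lemma mxpad_cstar m n m' n' (x : 'M[A]_(m, n)) :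
  mxpad n' m' (mxcstar x) = mxcstar (mxpad m' n' x).
Proof.
apply/matrixP => i j; rewrite !mxE /mxentry.
case: (insub (val i)) => [i'|]; case: (insub (val j)) => [j'|];
  by rewrite ?mxE ?cstar0.
Qed.

Lemma mxentry_pad_in m n m' n' (x : 'M[A]_(m, n)) i j : (i < m')%N -> (j < n')%N ->
  mxentry (mxpad m' n' x) i j = mxentry x i j.
Proof.
by move=> im jn; rewrite {1}(_ : i = Ordinal im) // {1}(_ : j = Ordinal jn) //
  mxentryE mxE.
Qed.

Lemma mxentry_pad m n m' n' (x : 'M[A]_(m, n)) i j : (m <= m')%N -> (n <= n')%N ->
  mxentry (mxpad m' n' x) i j = mxentry x i j.
Proof.
move=> mm' nn'; have [/andP[im jn]|ij] := boolP ((i < m') && (j < n'))%N.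
  by rewrite mxentry_pad_in.
rewrite !mxentry_out //; apply: contra ij => /andP[im jn].
by rewrite (leq_trans im) ?(leq_trans jn).
Qed.

Lemma mxentry_inj m n (x y : 'M[A]_(m, n)) : mxentry x =2 mxentry y -> x = y.
Proof. by move=> xy; apply/matrixP => i j; rewrite -!mxentryE xy. Qed.

Lemma mxpad_inj m n m' n' (x y : 'M[A]_(m, n)) : (m <= m')%N -> (n <= n')%N ->
  mxpad m' n' x = mxpad m' n' y -> x = y.
Proof.
move=> mm' nn' xy; apply: mxentry_inj => i j.
by rewrite -(mxentry_pad _ i j mm' nn') xy mxentry_pad.
Qed.

Lemma mxproj_block k l (p : 'M[A]_k) (q : 'M[A]_l) :
  mxproj p -> mxproj q -> mxproj (block_mx p 0 0 q).
Proof.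
move=> /andP[/eqP pp /eqP ps] /andP[/eqP qq /eqP qs]; apply/andP; split; apply/eqP.
  by rewrite mxcmul_block !mxcmul0l !mxcmul0r !addr0 !add0r pp qq.
by rewrite mxcstar_block ps qs !mxcstar0.
Qed.

Lemma mxproj0 k : mxproj (0 : 'M[A]_k).
Proof. by rewrite /mxproj mxcmul0l mxcstar0 !eqxx. Qed.

Lemma mxproj_pad n k (p : 'M[A]_k) : (k <= n)%N -> mxproj p -> mxproj (mxpad n n p).
Proof.
move=> kn /andP[/eqP pp /eqP ps]; apply/andP.
by rewrite -mxpad_cstar -mxpadM // pp ps.
Qed.

Lemma mxprojD k (p q : 'M[A]_k) :
  mxproj p -> mxproj q -> mxcmul p q = 0 -> mxproj (p + q).
Proof.
move=> /andP[/eqP pp /eqP ps] /andP[/eqP qq /eqP qs] pq; apply/andP; split; apply/eqP.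
  have qp : mxcmul q p = 0 by rewrite -ps -qs -mxcstarM pq mxcstar0.
  by rewrite mxcmulDl !mxcmulDr pp qq pq qp addr0 add0r.
by rewrite mxcstarD ps qs.
Qed.

End Matrices.

(* An element of P_oo(A) is given by a representative in some M_k(A). The
   identification of M_k(A) with a corner of M_n(A), k <= n, is implemented by
   mxpad in mvn below; see Vclass_pad and weight_mx_pad for the compatibility. *)
Definition Pinf (R : realType) (A : cstarAlgType R) :=
  {p : {k : nat & 'M[A]_k} | mxproj (tagged p)}.

HB.instance Definition _ (R : realType) (A : cstarAlgType R) :=
  Choice.on (Pinf A).

Section Equivalence.
Context {R : realType} {A : cstarAlgType R}.
Implicit Types e f g : Pinf A.

Definition psize e : nat := tag (val e).
Definition pmx e : 'M[A]_(psize e) := tagged (val e).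
Definition pinf k (p : 'M[A]_k) (hp : mxproj p) : Pinf A :=
  Sub (Tagged (fun k => 'M[A]_k) p) hp.

Lemma pmxP e : mxproj (pmx e).
Proof. exact: (valP e). Qed.

Definition mvn e f : Prop :=
  exists n (v : 'M[A]_n),
    [/\ (psize e <= n)%N, (psize f <= n)%N,
        mxcmul v (mxcstar v) = mxpad n n (pmx e) &
        mxcmul (mxcstar v) v = mxpad n n (pmx f)].

Definition mvnb e f : bool := `[< mvn e f >].

Lemma mvn_rect e f : mvn e f <->
  exists w : 'M[A]_(psize e, psize f),
    mxcmul w (mxcstar w) = pmx e /\ mxcmul (mxcstar w) w = pmx f.
Proof.
move: (pmxP e) (pmxP f); rewrite /mvn; move: (psize e) (psize f) (pmx e) (pmx f).
move=> k l p q pP qP; have /andP[/eqP pp /eqP ps] := pP.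
have /andP[/eqP qq /eqP qs] := qP; split=> [[n [v [kn ln vv vv']]]|[w [ww ww']]].
  pose P := mxpad n n p; pose Q := mxpad n n q.
  have PP : mxcmul P P = P by rewrite -mxpadM // pp.
  have QQ : mxcmul Q Q = Q by rewrite -mxpadM // qq.
  have Ps : mxcstar P = P by rewrite -mxpad_cstar ps.
  have Qs : mxcstar Q = Q by rewrite -mxpad_cstar qs.
  pose W := mxcmul (mxcmul P v) Q.
  have vQ : mxcmul v Q = mxcmul P v by rewrite /Q -vv' mxcmulA vv.
  have WE : W = mxcmul P v by rewrite /W -mxcmulA vQ mxcmulA PP.
  have WE' : W = mxcmul v Q by rewrite WE -vQ.
  have WW : mxcmul W (mxcstar W) = P.
    by rewrite WE mxcstarM Ps mxcmulA -[mxcmul (mxcmul P v) _]mxcmulA vv -/P !PP.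
  have WW' : mxcmul (mxcstar W) W = Q.
    by rewrite WE' mxcstarM Qs mxcmulA -[mxcmul (mxcmul Q _) v]mxcmulA vv' -/Q !QQ.
  have W0 : mxpad n n (mxpad k l W) = W.
    apply: mxentry_inj => i j; rewrite mxentry_pad //.
    have [/andP[ik jl]|ij] := boolP ((i < k) && (j < l))%N.
      by rewrite mxentry_pad_in.
    rewrite mxentry_out //; symmetry; move: ij; rewrite negb_and => /orP[h|h].
      rewrite WE (mxentryM _ _ _ _ (leqnn n)) big1 // => t _.
      by rewrite mxentry_pad // mxentry_out ?negb_and ?h // cmul0l.
    rewrite WE' (mxentryM _ _ _ _ (leqnn n)) big1 // => t _.
    by rewrite (mxentry_pad q) // (@mxentry_out _ _ _ _ q) ?negb_and ?h ?orbT // cmul0r.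
  exists (mxpad k l W); split.
    apply: (mxpad_inj kn kn); rewrite (mxpadM _ _ _ _ ln).
    by rewrite mxpad_cstar W0.
  apply: (mxpad_inj ln ln); rewrite (mxpadM _ _ _ _ kn).
  by rewrite mxpad_cstar W0.
exists (k + l)%N, (mxpad _ _ w); split; rewrite ?leq_addr ?leq_addl //.
  by rewrite -mxpad_cstar -mxpadM ?leq_addl // ww.
by rewrite -mxpad_cstar -mxpadM ?leq_addr // ww'.
Qed.

Lemma mvn_refl e : mvn e e.
Proof.
by apply/mvn_rect; exists (pmx e); have /andP[/eqP pp /eqP ps] := pmxP e; rewrite ps.
Qed.

Lemma mvn_sym e f : mvn e f -> mvn f e.
Proof. by case=> n [v [en fn vv vv']]; exists n, (mxcstar v); rewrite mxcstarK. Qed.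

Lemma mvn_trans f e g : mvn e f -> mvn f g -> mvn e g.
Proof.
move=> /mvn_rect[v [vv vv']] /mvn_rect[w [ww ww']]; apply/mvn_rect.
exists (mxcmul v w); rewrite mxcstarM.
have /andP[/eqP ee _] := pmxP e; have /andP[/eqP gg _] := pmxP g; split.
  by rewrite mxcmulA -(mxcmulA v w) ww -vv' mxcmulA vv -mxcmulA vv ee.
by rewrite mxcmulA -(mxcmulA (mxcstar w)) vv' -ww mxcmulA ww' -mxcmulA ww' gg.
Qed.

Lemma mvnb_refl : reflexive mvnb.
Proof. by move=> e; apply/asboolP/mvn_refl. Qed.

Lemma mvnb_sym : symmetric mvnb.
Proof. by move=> e f; apply/asboolP/asboolP => /mvn_sym. Qed.

Lemma mvnb_trans : transitive mvnb.
Proof. by move=> f e g /asboolP ef /asboolP fg; apply/asboolP/(mvn_trans ef). Qed.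

Canonical mvn_equiv := EquivRel mvnb mvnb_refl mvnb_sym mvnb_trans.

End Equivalence.

Definition Vsemigroup (R : realType) (A : cstarAlgType R) := {eq_quot (@mvnb R A)}.

HB.instance Definition _ (R : realType) (A : cstarAlgType R) :=
  Choice.on (Vsemigroup A).
HB.instance Definition _ (R : realType) (A : cstarAlgType R)
  : EqQuotient _ (@mvnb R A) (Vsemigroup A) := EqQuotient.on (Vsemigroup A).

Section Semigroup.
Context {R : realType} {A : cstarAlgType R}.
Implicit Types e f g : Pinf A.

Definition Vclass e : Vsemigroup A := \pi_(Vsemigroup A) e.

Lemma VclassP e f : Vclass e = Vclass f <-> mvn e f.
Proof. by split=> [/eqmodP/asboolP|ef]; last by apply/eqmodP/asboolP. Qed.

(* This is p' + f, where p' = block_mx 0 0 0 (pmx e) is equivalent to e and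
   orthogonal to f; see VclassD for arbitrary orthogonal projections. *)
Definition pdsum e f : Pinf A := pinf (mxproj_block (pmxP f) (pmxP e)).

Definition Vadd (x y : Vsemigroup A) : Vsemigroup A := Vclass (pdsum (repr x) (repr y)).
Definition Vzero : Vsemigroup A := Vclass (pinf (mxproj0 0)).

Lemma mvn_dsum e e' f f' : mvn e e' -> mvn f f' -> mvn (pdsum e f) (pdsum e' f').
Proof.
move=> /mvn_rect[v [vv vv']] /mvn_rect[w [ww ww']]; apply/mvn_rect.
exists (block_mx w 0 0 v); rewrite mxcstar_block !mxcstar0 !mxcmul_block.
by rewrite !mxcmul0l !mxcmul0r !addr0 !add0r vv vv' ww ww'.
Qed.

Lemma Vadd_class e f : Vadd (Vclass e) (Vclass f) = Vclass (pdsum e f).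
Proof.
by apply/VclassP/mvn_dsum; apply/VclassP; rewrite /Vclass reprK.
Qed.

Lemma VaddC : commutative Vadd.
Proof.
move=> x y; rewrite /Vadd; apply/VclassP/mvn_rect; set e := repr x; set f := repr y.
have /andP[/eqP ee /eqP es] := pmxP e; have /andP[/eqP ff /eqP fs] := pmxP f.
exists (block_mx 0 (pmx f) (pmx e) 0); rewrite mxcstar_block !mxcstar0 es fs.
by rewrite !mxcmul_block !mxcmul0l !mxcmul0r !addr0 !add0r ee ff.
Qed.

Lemma mvn_entry e f : mxentry (pmx e) =2 mxentry (pmx f) -> mvn e f.
Proof.
move=> ef; exists (psize e + psize f)%N, (mxpad _ _ (pmx e)).
have /andP[/eqP ee /eqP es] := pmxP e.
rewrite leq_addr leq_addl -mxpad_cstar es -mxpadM ?leq_addr // ee; split=> //.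
by apply/matrixP => i j; rewrite !mxE ef.
Qed.

Lemma mxentry_cast m n m' n' (c : (m = m') * (n = n')) (x : 'M[A]_(m, n)) :
  mxentry (castmx c x) =2 mxentry x.
Proof. by case: c => c1 c2; case: m' / c1; case: n' / c2 => i j; rewrite castmx_id. Qed.

Lemma VaddA : associative Vadd.
Proof.
move=> x y z; rewrite -[x]reprK -[y]reprK -[z]reprK -!/(Vclass _) !Vadd_class.
apply/VclassP/mvn_entry => i j; rewrite /pdsum /pmx /=.
have := congr1 (fun m => mxentry m i j)
  (@block_mxA A _ _ _ _ _ _ (pmx (repr z)) 0 0 0 (pmx (repr y)) 0 0 0
    (pmx (repr x))).
by rewrite /= mxentry_cast !row_mx0 !col_mx0 => E; symmetry; exact: E.
Qed.

Lemma Vadd0 : left_id Vzero Vadd.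
Proof.
move=> x; rewrite -[x]reprK -!/(Vclass _) /Vzero Vadd_class.
apply/VclassP/mvn_rect; set e := repr x; have /andP[/eqP ee /eqP es] := pmxP e.
exists (col_mx (pmx e) 0); rewrite mxcstar_col mxcstar0 es mxcmul_col_row mxcmul_row_col.
by rewrite !mxcmul0l !mxcmul0r addr0 ee.
Qed.

HB.instance Definition _ := GRing.isNmodule.Build (Vsemigroup A) VaddA VaddC Vadd0.

Lemma VclassD n (p q : 'M[A]_n) (hp : mxproj p) (hq : mxproj q)
    (pq : mxcmul p q = 0) :
  Vclass (pinf (mxprojD hp hq pq)) = Vclass (pinf hp) + Vclass (pinf hq).
Proof.
have -> : forall e f, Vclass e + Vclass f = Vclass (pdsum e f) by exact: Vadd_class.
apply/VclassP/mvn_sym/mvn_rect; have /andP[/eqP pp /eqP ps] := hp.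
have /andP[/eqP qq /eqP qs] := hq.
have qp : mxcmul q p = 0 by rewrite -ps -qs -mxcstarM pq mxcstar0.
exists (col_mx q p); rewrite mxcstar_col ps qs mxcmul_col_row mxcmul_row_col pp qq pq qp.
by split=> //; exact: addrC.
Qed.

Lemma Vclass_pad n k (p : 'M[A]_k) (hp : mxproj p) (kn : (k <= n)%N) :
  Vclass (pinf (mxproj_pad kn hp)) = Vclass (pinf hp).
Proof. by apply/VclassP/mvn_entry => i j; rewrite [LHS]mxentry_pad. Qed.

End Semigroup.

Section GrothendieckRel.
Context {M : nmodType}.

(* The pair (a, b) represents the formal difference of a and b. *)
Definition groth_rel (x y : M * M) : bool :=
  `[< exists c, x.1 + y.2 + c = y.1 + x.2 + c >].

Lemma groth_refl : reflexive groth_rel.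
Proof. by move=> x; apply/asboolP; exists 0. Qed.

Lemma groth_sym : symmetric groth_rel.
Proof. by move=> x y; apply/asboolP/asboolP => -[c xy]; exists c. Qed.

Lemma groth_trans : transitive groth_rel.
Proof.
move=> y x t /asboolP[c xy] /asboolP[d yt]; apply/asboolP.
exists (y.2 + y.1 + c + d).
transitivity ((x.1 + y.2 + c) + (y.1 + t.2 + d)).
  by rewrite (AC (2*4) ((1*3*5)*(4*2*6))).
by rewrite xy yt (AC (3*3) ((4*2)*(5*1*3*6))).
Qed.

Canonical groth_equiv := EquivRel groth_rel groth_refl groth_sym groth_trans.

End GrothendieckRel.

Definition groth (M : nmodType) := {eq_quot (@groth_rel M)}.

HB.instance Definition _ (M : nmodType) := Choice.on (groth M).
HB.instance Definition _ (M : nmodType)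
  : EqQuotient _ (@groth_rel M) (groth M) := EqQuotient.on (groth M).

Section Grothendieck.
Context {M : nmodType}.
Implicit Types x y z : groth M.

Definition gdiff (a b : M) : groth M := \pi_(groth M) (a, b).
Definition gadd x y : groth M :=
  gdiff ((repr x).1 + (repr y).1) ((repr x).2 + (repr y).2).
Definition gopp x : groth M := gdiff (repr x).2 (repr x).1.
Definition gzero : groth M := gdiff 0 0.

Lemma gdiffP a b a' b' :
  gdiff a b = gdiff a' b' <-> exists c, a + b' + c = a' + b + c.
Proof. by split=> [/eqmodP/asboolP|h]; last by apply/eqmodP/asboolP. Qed.

Lemma gdiff_repr x : x = gdiff (repr x).1 (repr x).2.
Proof. by rewrite /gdiff -surjective_pairing reprK. Qed.

Lemma gaddE a b a' b' : gadd (gdiff a b) (gdiff a' b') = gdiff (a + a') (b + b').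
Proof.
rewrite /gadd; have /gdiffP[c h] := gdiff_repr (gdiff a b).
have /gdiffP[c' h'] := gdiff_repr (gdiff a' b').
apply/gdiffP; exists (c + c').
set u := repr _ in h *; set u' := repr _ in h' *.
transitivity ((u.1 + b + c) + (u'.1 + b' + c')).
  by rewrite (AC (2*2*2) ((1*3*5)*(2*4*6))).
by rewrite -h -h' (AC (3*3) ((1*4)*(2*5)*(3*6))).
Qed.

Lemma goppE a b : gopp (gdiff a b) = gdiff b a.
Proof.
rewrite /gopp; have /gdiffP[c h] := gdiff_repr (gdiff a b).
by apply/gdiffP; exists c; rewrite [X in X + c = _]addrC h addrC [b + _]addrC addrC.
Qed.

Lemma gaddA : associative gadd.
Proof.
move=> x y z; rewrite (gdiff_repr x) (gdiff_repr y) (gdiff_repr z).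
by rewrite !gaddE !addrA.
Qed.

Lemma gaddC : commutative gadd.
Proof.
move=> x y; rewrite (gdiff_repr x) (gdiff_repr y) !gaddE.
by congr gdiff; rewrite addrC.
Qed.

Lemma gadd0 : left_id gzero gadd.
Proof. by move=> x; rewrite (gdiff_repr x) gaddE !add0r. Qed.

Lemma gaddN : left_inverse gzero gopp gadd.
Proof.
move=> x; rewrite (gdiff_repr x) goppE gaddE.
by apply/gdiffP; exists 0; rewrite !addr0 !add0r addrC.
Qed.

HB.instance Definition _ := GRing.isZmodule.Build (groth M) gaddA gaddC gadd0 gaddN.

Definition groth_of (a : M) : groth M := gdiff a 0.

End Grothendieck.

Definition K00 (R : realType) (A : cstarAlgType R) := groth (Vsemigroup A).
HB.instance Definition _ (R : realType) (A : cstarAlgType R) :=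
  GRing.Zmodule.on (K00 A).

Definition K00class (R : realType) (A : cstarAlgType R) (e : Pinf A) : K00 A :=
  groth_of (Vclass e).

Section WeightsOnProjections.
Context {R : realType} {A : cstarAlgType R}.
Local Open Scope ereal_scope.

Definition weight_mx (psi : A -> \bar R) k (x : 'M[A]_k) : \bar R :=
  \sum_(i < k) psi (x i i).

Lemma weight_mx_pad (psi : A -> \bar R) n k (x : 'M[A]_k) :
  weight psi -> (k <= n)%N -> weight_mx psi (mxpad n n x) = weight_mx psi x.
Proof.
move=> wpsi kn; transitivity (\sum_(i < n) psi (mxentry x i i)).
  by apply: eq_bigr => i _; rewrite mxE.
transitivity (\sum_(i < k) psi (mxentry x i i)); last first.
  by apply: eq_bigr => i _; rewrite mxentryE.
rewrite [RHS](big_ord_widen n (fun i => psi (mxentry x i i))) // [RHS]big_mkcond.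
apply: eq_bigr => i _; case: ltnP => // ki.
by rewrite mxentry_out ?weight0 // negb_and -leqNgt ki.
Qed.

Definition weight_inf (psi : A -> \bar R) (e : Pinf A) : \bar R :=
  weight_mx psi (pmx e).

Definition weight_lower (psi : A -> \bar R) (e : Pinf A) : \bar R :=
  ereal_inf [set weight_inf psi f | f in [set f | mvn f e]].

End WeightsOnProjections.

(* Main.v *)
From HB Require Import structures.
Require Import Defs.
From mathcomp Require Import all_boot all_order all_algebra.
From mathcomp Require Import complex.
From mathcomp Require Import boolp classical_sets.
From mathcomp Require Import reals ereal.
From mathcomp Require Import topology normedtype sequences.
From mathcomp Require Import ring lra.

(** The proof has three ingredients.

    Positivity. The weight psi only behaves on the positive cone, which is
    defined by the spectrum, so one needs to know that every finite sum of
    elements x x^* is positive. Work in the unitization with its C*-norm N, and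
    call a self-adjoint a norm-positive when N (r - a) <= r for some r > 0.
    This class is stable under sums for trivial reasons, contains the squares
    of self-adjoint elements ([norm_positive_sqr]), and its elements have
    nonnegative spectrum ([norm_positive_spectrum]). That it contains x x^* is
    [norm_positive_mul_star]. There is no functional calculus in the
    argument: the only analytic input is the square root of an element within
    distance < r of a scalar r ([near_scalar_sqrt]), which comes from a
    contraction, and the passage from large scalars r to small ones for the
    resolvents of x x^* rests on an a priori bound ([resolvent_bound]) obtained
    from z z^* + z^* z = 2 (p^2 + q^2) for z = p + i q.

    Finiteness. The x with psi (x x^* ) finite form a right ideal. Density of
    the domain of psi makes every positive element a limit of members of this
    ideal, hence by polarization every product y z^*, hence every entry of a
    projection e in M_k(A). If a matrix X with entries in the right ideal is
    close enough to e, then e X^* X e is invertible in the corner of e, and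
    w = X (e X^* X e)^(-1/2) satisfies w^* w = e, has entries in the right
    ideal, and w w^* is a projection equivalent to e of finite weight
    ([finite_representative]).

    Additivity. If g is equivalent to e + f with e f = 0 through w, then
    g = w e w^* + w f w^* splits g into projections equivalent to e and to f.
    As the diagonal entries of the two summands are sums of elements x x^*, the
    weight is additive here, so the lower weight of e + f is at least the sum
    of the lower weights; the other inequality is clear from block sums. The
    lower weight is thus a finite additive function on V(A), and extends to
    differences. *)

Set Implicit Arguments.
Unset Strict Implicit.
Unset Printing Implicit Defensive.

Import Order.TTheory GRing.Theory Num.Theory.
Import numFieldNormedType.Exports.

Local Open Scope classical_set_scope.
Local Open Scope ring_scope.
Local Notation "r %:C" := (real_complex _ r).

(** * Square roots and inverses in Banach *-rings *)

Section Smallness.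
Context {R : realType}.

Lemma le0_eps (a K : R) : (forall e, 0 < e -> a <= K * e) -> a <= 0.
Proof.
move=> aK; rewrite leNgt; apply/negP => a0.
have K0 : 0 < `|K| + 1 by rewrite ltr_wpDl.
have e0 : 0 < a / 2 / (`|K| + 1) by rewrite !divr_gt0.
have := aK _ e0; rewrite leNgt => /negP; apply.
apply: (@le_lt_trans _ _ (a / 2)); last by lra.
rewrite mulrC -[leLHS]mulrA ler_piMr //; first by lra.
rewrite mulrC ler_pdivrMr // mul1r.
by apply: (le_trans (ler_norm _)); rewrite lerDl.
Qed.

Lemma expr_small (q e : R) : 0 <= q < 1 -> 0 < e ->
  exists n0, forall n, (n0 <= n)%N -> q ^+ n <= e.
Proof.
move=> /andP[q0 q1] e0.
have /cvgrPdist_le/(_ _ e0)[n0 _ H] : (fun n => q ^+ n) @ \oo --> (0 : R).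
  by apply: cvg_expr; rewrite ger0_norm.
exists n0 => n n0n; have := H n n0n.
by rewrite sub0r normrN ger0_norm ?exprn_ge0.
Qed.

End Smallness.

Section BanachStarRing.
Context {R : realType}.

Definition cauchy_seq (B : zmodType) (N : B -> R) (u : nat -> B) :=
  forall e, 0 < e -> exists n0, forall m n, (n0 <= m)%N -> (n0 <= n)%N ->
    N (u m - u n) <= e.

Definition converges_to (B : zmodType) (N : B -> R) (u : nat -> B) l :=
  forall e, 0 < e -> exists n0, forall n, (n0 <= n)%N -> N (l - u n) <= e.

(** Rings rather than complex algebras, so that matrices over the unitization
    are an instance; [bhalf] is what is left of the scalars, and is what the
    iteration for square roots divides by. The norm of 1 may
    exceed 1: it is k for the entrywise sum norm on k by k matrices. *)
Record banach_star_ring (B : pzRingType) (st : B -> B) (N : B -> R) : Prop := {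
  bnorm_ge0 : forall x, 0 <= N x;
  bnormD : forall x y, N (x + y) <= N x + N y;
  bnormN : forall x, N (- x) = N x;
  bnormM : forall x y, N (x * y) <= N x * N y;
  bnorm0_eq0 : forall x, N x = 0 -> x = 0;
  bnorm_complete : forall u, cauchy_seq N u -> exists l, converges_to N u l;
  bstarD : {morph st : x y / x + y};
  bstarM : forall x y, st (x * y) = st y * st x;
  bstar1 : st 1 = 1;
  bnorm_star : forall x, N (st x) = N x;
  bhalf : exists h, [/\ h + h = 1, st h = h, forall x, h * x = x * h &
    forall x, N (h * x) <= N x / 2]
}.

Context {B : pzRingType} {st : B -> B} {N : B -> R}.
Context (BB : banach_star_ring st N).

Lemma bnormB x y : N (x - y) <= N x + N y.
Proof. by rewrite (le_trans (bnormD BB _ _)) ?(bnormN BB). Qed.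

Lemma bdistC x y : N (x - y) = N (y - x).
Proof. by rewrite -(bnormN BB) opprB. Qed.

Lemma bnorm_tri x y z : N (x - z) <= N (x - y) + N (y - z).
Proof. by rewrite (le_trans _ (bnormD BB _ _)) // addrA subrK. Qed.

Lemma bnorm0 : N 0 = 0.
Proof.
have := bnormM BB 0 0; rewrite mul0r => h.
have [h1 h2] := (bhalf BB); case: h2 => e1 e2 e3 e4.
by have := e4 0; rewrite mulr0; have := bnorm_ge0 BB 0; lra.
Qed.

Lemma bnorm_eps0 x K : (forall e, 0 < e -> N x <= K * e) -> x = 0.
Proof.
move=> h; apply: (bnorm0_eq0 BB); apply/eqP; rewrite eq_le (bnorm_ge0 BB) andbT.
exact: (le0_eps h).
Qed.

Lemma bstarB x y : st (x - y) = st x - st y.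
Proof.
have st0 : st 0 = 0 by apply: (addrI (st 0)); rewrite -(bstarD BB) !addr0.
rewrite (bstarD BB); congr (_ + _); apply: (addrI (st y)).
by rewrite -(bstarD BB) !subrr.
Qed.

Definition adherent (S : B -> Prop) x := forall e, 0 < e -> exists2 y, S y & N (x - y) <= e.

(** Banach's fixed point theorem, for a ring normed by an arbitrary real valued
    function and a closed set S on which F contracts. *)
Lemma contraction_fixpoint (S : B -> Prop) (F : B -> B) (q : R) x0 :
  0 <= q < 1 -> S x0 -> (forall x, S x -> S (F x)) ->
  (forall x y, S x -> S y -> N (F x - F y) <= q * N (x - y)) ->
  (forall x, adherent S x -> S x) ->
  exists2 x, S x & F x = x.
Proof.
move=> q01 S0 SF FL Scl; have /andP[q0 q1] := q01.
pose x n := iter n F x0.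
have Sx n : S (x n) by elim: n => // n; exact: SF.
pose D := N (x 1%N - x 0%N) / (1 - q).
have D0 : 0 <= D by rewrite divr_ge0 ?(bnorm_ge0 BB) // subr_ge0 ltW.
have dk k : N (x k - x 0%N) <= D.
  elim: k => [|k IH]; first by rewrite subrr bnorm0.
  apply: (le_trans (bnorm_tri _ (x 1%N) _)).
  have -> : D = q * D + N (x 1%N - x 0%N).
    by rewrite /D; field; rewrite subr_eq0 eq_sym lt_eqF.
  by rewrite lerD2r (le_trans (FL _ _ (Sx k) (Sx 0%N))) // ler_wpM2l.
have dnk n k : N (x (n + k)%N - x n) <= q ^+ n * D.
  elim: n k => [|n IH] k; first by rewrite expr0 mul1r dk.
  rewrite addSn (le_trans (FL _ _ (Sx _) (Sx _))) // exprS -mulrA.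
  by rewrite ler_wpM2l.
have xc : cauchy_seq N x.
  move=> e e0; have e20 : 0 < e / 2 / (D + 1) by rewrite !divr_gt0 ?ltr_wpDl.
  have [n0 Hn0] := expr_small q01 e20.
  have H m : (n0 <= m)%N -> N (x m - x n0) <= e / 2.
    move=> /subnKC <-; apply: (le_trans (dnk _ _)).
    apply: (@le_trans _ _ (q ^+ n0 * (D + 1))).
      by rewrite ler_wpM2l ?exprn_ge0 // lerDl.
    by rewrite -ler_pdivlMr ?ltr_wpDl // Hn0.
  exists n0 => m n mn nn; apply: (le_trans (bnorm_tri _ (x n0) _)).
  by rewrite (bdistC (x n0)); have := H _ mn; have := H _ nn; lra.
have [l xl] := bnorm_complete BB xc.
have Sl : S l.
  by apply: Scl => e e0; have [n0 H] := xl e e0; exists (x n0) => //; apply: H.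
exists l => //; apply/eqP; rewrite -subr_eq0; apply/eqP/(@bnorm_eps0 _ 2) => e e0.
have [n0 H] := xl e e0; apply: (le_trans (bnorm_tri _ (x n0.+1) _)).
have := FL _ _ Sl (Sx n0); rewrite -[F (x n0)]/(x n0.+1).
have := H n0 (leqnn _); have := H n0.+1 (leqnSn _); rewrite (bdistC l (x n0.+1)).
have := ler_wpM2r (bnorm_ge0 BB (l - x n0)) (ltW q1); lra.
Qed.

(** Self-adjointness and commutation with a given z are kernels of bounded
    additive maps, so they survive the limit in the fixed point theorem. *)
Lemma kernel_closed (L : B -> B) (K : R) (x : B) :
  (forall x y, L (x - y) = L x - L y) -> (forall x, N (L x) <= K * N x) -> 0 <= K ->
  adherent (fun y => L y = 0) x -> L x = 0.
Proof.
move=> LB LK K0 xcl; apply: (@bnorm_eps0 _ K) => e e0; have [y Ly xy] := xcl e e0.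
by rewrite -[L x]subr0 -Ly -LB (le_trans (LK _)) // ler_wpM2l.
Qed.

Lemma commute_closed z x :
  adherent (fun y => z * y = y * z) x -> z * x = x * z.
Proof.
move=> xcl; apply/eqP; rewrite -subr_eq0; apply/eqP.
apply: (@kernel_closed (fun x => z * x - x * z) (2 * N z)).
- by move=> a b; rewrite mulrBr mulrBl; rewrite !opprD !opprK addrACA.
- move=> a; apply: (le_trans (bnormB _ _)).
  by have := bnormM BB z a; have := bnormM BB a z; lra.
- by rewrite mulr_ge0 ?(bnorm_ge0 BB).
- by move=> e /xcl[y yz xy]; exists y => //; rewrite yz subrr.
Qed.

Lemma star_closed x : adherent (fun y => st y = y) x -> st x = x.
Proof.
move=> xcl; apply/eqP; rewrite -subr_eq0; apply/eqP.
apply: (@kernel_closed (fun x => st x - x) 2).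
- by move=> a b; rewrite bstarB !opprD !opprK addrACA.
- by move=> a; apply: (le_trans (bnormB _ _)); rewrite (bnorm_star BB); lra.
- by [].
- by move=> e /xcl[y yz xy]; exists y => //; rewrite yz subrr.
Qed.

Lemma adherent_sub (S S' : B -> Prop) x : (forall y, S y -> S' y) ->
  adherent S x -> adherent S' x.
Proof. by move=> SS' Sx e /Sx[y /SS' S'y xy]; exists y. Qed.

Lemma neumann_inverse w : N w < 1 ->
  exists j, (1 - w) * j = 1 /\ j * (1 - w) = 1.
Proof.
move=> w1.
have [|||||g wg Fg] := @contraction_fixpoint (fun g => w * g = g * w)
  (fun g => w + w * g) (N w) 0.
- by rewrite (bnorm_ge0 BB).
- by rewrite mulr0 mul0r.
- by move=> x wx; rewrite mulrDr mulrDl -mulrA -wx.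
- by move=> x y _ _; rewrite opprD addrACA subrr add0r -mulrBr (bnormM BB).
- exact: commute_closed.
exists (1 + g); rewrite mulrBl mul1r mulrDr mulr1 Fg addrK.
by rewrite mulrBr mulr1 mulrDl mul1r -wg Fg addrK.
Qed.

(** Writing the root as 1 - w turns the equation into w = (u + w w) / 2, whose
    right hand side contracts a ball of radius < 1. The iterates are
    polynomials in u, hence the commutation property of the root. *)
Lemma near_one_sqrt u : N u < 1 -> st u = u ->
  exists c c', [/\ c * c = 1 - u, c * c' = 1, c' * c = 1, st c = c &
    forall z, z * u = u * z -> z * c = c * z].
Proof.
move=> u1 us; have [h [hh hs hC hN]] := bhalf BB.
(* Any p < 1 with N u <= 2 p - p^2 would do: the ball of radius p is stable. *)
pose p := (1 + N u) / 2; have u0 := bnorm_ge0 BB u.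
have p0 : 0 <= p by rewrite /p; lra.
have p1 : p < 1 by rewrite /p; lra.
have up : N u <= 2 * p - p ^+ 2 by rewrite /p; nra.
have [|||||w [wp ws wz] Fw] := @contraction_fixpoint
  (fun w => [/\ N w <= p, st w = w & forall z, z * u = u * z -> z * w = w * z])
  (fun w => h * (u + w * w)) p 0.
- by rewrite p0.
- split; first by rewrite bnorm0.
    by have := bstarB 0 0; rewrite !subrr.
  by move=> z _; rewrite mulr0 mul0r.
- move=> w [wp ws wz]; split.
  + apply: (le_trans (hN _)); have := bnormD BB u (w * w); have := bnormM BB w w.
    have := bnorm_ge0 BB w; nra.
  + by rewrite (bstarM BB) (bstarD BB) (bstarM BB) us ws hs -hC.
  + move=> z zu; rewrite mulrA -(hC z) -!mulrA; congr (_ * _).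
    by rewrite mulrDr mulrDl zu mulrA (wz _ zu) -!mulrA (wz _ zu).
- move=> x y [xp _ _] [yp _ _]; rewrite -mulrBr (le_trans (hN _)) //.
  have -> : u + x * x - (u + y * y) = x * (x - y) + (x - y) * y.
    by rewrite opprD addrACA subrr add0r mulrBr mulrBl addrA subrK.
  have := bnormD BB (x * (x - y)) ((x - y) * y).
  have := bnormM BB x (x - y); have := bnormM BB (x - y) y.
  have := bnorm_ge0 BB (x - y); nra.
- move=> x xcl; split.
  + rewrite -subr_le0; apply: (@le0_eps _ _ 1) => e /xcl[y [yp _ _] xy].
    by have := bnormD BB (x - y) y; rewrite subrK; lra.
  + by apply/star_closed/(adherent_sub _ xcl) => y [].
  + by move=> z zu; apply/commute_closed/(adherent_sub _ xcl) => y [_ _]; exact.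
have [c' [cc' c'c]] := neumann_inverse (le_lt_trans wp p1).
exists (1 - w), c'; split=> //.
- have ww : w + w = u + w * w by rewrite -{1 2}Fw -mulrDl hh mul1r.
  rewrite mulrBr mulr1 mulrBl mul1r opprB -[u](addrK (w * w)) -ww opprB.
  by rewrite opprD -!addrA; congr (_ + _); rewrite addrCA.
- by rewrite bstarB (bstar1 BB) ws.
- by move=> z /wz zw; rewrite mulrBr mulrBl mul1r mulr1 zw.
Qed.

End BanachStarRing.

(** * Positivity in unital C*-algebras *)

Definition invertible (B : pzRingType) (x : B) := exists y, x * y = 1 /\ y * x = 1.

Section UnitalCStar.
Context {R : realType}.
Local Notation C := (R[i]).

Lemma real_complexM (a b : R) : (a * b)%:C = a%:C * b%:C :> C.
Proof. exact: rmorphM. Qed.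
Lemma real_complexD (a b : R) : (a + b)%:C = a%:C + b%:C :> C.
Proof. exact: rmorphD. Qed.

Lemma conj_i : ('i%C : C)^* = - 'i%C.
Proof. by apply/eqP; rewrite eq_complex /= oppr0 !eqxx. Qed.

Lemma mul_ii : 'i%C * 'i%C = -1 :> C.
Proof. by rewrite -expr2 sqr_i. Qed.

Lemma norm_i : `|'i%C : C| = 1.
Proof. by rewrite normc_def /= expr0n expr1n add0r sqrtr1. Qed.

Lemma conj_real r : (r%:C : C)^* = r%:C.
Proof. exact: conjc_real. Qed.

Record unital_cstar_algebra (B : algType C) (st : B -> B) (N : B -> R) : Prop := {
  ucstar_banach :> banach_star_ring st N;
  ucstarK : involutive st;
  ucstarZ : forall c x, st (c *: x) = c^* *: st x;
  ucnormZ : forall c x, N (c *: x) = complex.Re `|c| * N x;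
  ucnorm1 : N 1 <= 1;
  ucnorm_star_mul : forall x, N x ^+ 2 <= N (st x * x)
}.

Context {B : algType C} {st : B -> B} {N : B -> R}.
Context (BC : unital_cstar_algebra st N).
Implicit Types (x y z s c : B) (r m e : R).

Let BB : banach_star_ring st N := BC.

Lemma ucstarRZ r x : st (r%:C *: x) = r%:C *: st x.
Proof. by rewrite (ucstarZ BC) conj_real. Qed.

Lemma ucstar_real r : st (r%:C *: 1) = r%:C *: 1.
Proof. by rewrite ucstarRZ (bstar1 BB). Qed.

Lemma ucnormRZ r x : 0 <= r -> N (r%:C *: x) = r * N x.
Proof. by move=> r0; rewrite (ucnormZ BC) ger0_norm // lecR. Qed.

Lemma ucnorm_real_le r : 0 <= r -> N (r%:C *: 1) <= r.
Proof. by move=> r0; rewrite ucnormRZ // ler_piMr // (ucnorm1 BC). Qed.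

Lemma commuteZ1 (k : C) x : x * (k *: 1) = k *: 1 * x.
Proof. by rewrite -scalerAl -scalerAr mulr1 mul1r. Qed.

Lemma near_scalar_sqrt a r : st a = a -> 0 < r -> N (r%:C *: 1 - a) < r ->
  exists c c', [/\ c * c = a, c * c' = 1, c' * c = 1, st c = c &
    forall z, z * a = a * z -> z * c = c * z].
Proof.
move=> sa r0 ar; pose u := 1 - r^-1%:C *: a.
have rC (x : B) : r%:C *: (r^-1%:C *: x) = x.
  by rewrite scalerA -real_complexM divff ?gt_eqF // scale1r.
have ru : u = r^-1%:C *: (r%:C *: 1 - a).
  by rewrite /u scalerBr scalerA -real_complexM mulVf ?gt_eqF // scale1r.
have u1 : N u < 1.
  by rewrite ru ucnormRZ ?invr_ge0 ?(ltW r0) // mulrC ltr_pdivrMr // mul1r.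
have us : st u = u by rewrite (bstarB BB) (bstar1 BB) ucstarRZ sa.
have [c [c' [cc cc' c'c sc cz]]] := near_one_sqrt BB u1 us.
have sr0 : Num.sqrt r != 0 by rewrite gt_eqF // sqrtr_gt0.
exists ((Num.sqrt r)%:C *: c), ((Num.sqrt r)^-1%:C *: c').
have sE (p q : R) (x y : B) : (p%:C *: x) * (q%:C *: y) = (p * q)%:C *: (x * y).
  by rewrite -scalerAl -scalerAr scalerA -real_complexM.
rewrite !sE divff // mulVf // !scale1r cc' c'c; split=> //.
- by rewrite -expr2 sqr_sqrtr ?ltW // cc /u opprB addrC subrK rC.
- by rewrite ucstarRZ sc.
- move=> z za; rewrite -scalerAl -scalerAr cz // /u mulrBr mulrBl mulr1 mul1r.
  by rewrite -scalerAl -scalerAr za.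
Qed.

(** The element u = c + i s is normal with u^* u = m, so the C*-identity bounds
    N u, and c is the real part of u. *)
Lemma norm_le_sqr_sum c s m : st c = c -> st s = s -> c * s = s * c ->
  c * c + s * s = m%:C *: 1 -> 0 <= m -> N c ^+ 2 <= m.
Proof.
move=> cs ss csC csm m0; pose u := c + 'i%C *: s.
have su : st u = c - 'i%C *: s.
  by rewrite (bstarD BB) (ucstarZ BC) cs ss conj_i scaleNr.
have uu : st u * u = m%:C *: 1.
  rewrite su /u mulrDr !mulrBl -!scalerAl -!scalerAr scalerA mul_ii scaleN1r.
  by rewrite csC opprK addrA subrK -csm.
have Nu : N u ^+ 2 <= m by rewrite (le_trans (ucnorm_star_mul BC u)) // uu ucnorm_real_le.
have /(ucnormRZ c) : 0 <= 2 :> R by [].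
have -> : 2%:C *: c = u + st u.
  rewrite su addrACA subrr addr0 (_ : 2 = 1 + 1 :> R) //.
  by rewrite real_complexD scalerDl scale1r.
have := bnormD BB u (st u); rewrite (bnorm_star BB).
have := bnorm_ge0 BB c; have := bnorm_ge0 BB u; nra.
Qed.

(** A substitute for a nonnegative spectrum among self-adjoint elements, which
    is visibly stable under sums. *)
Definition norm_positive a := st a = a /\ exists2 r, 0 < r & N (r%:C *: 1 - a) <= r.

Lemma norm_positiveD a b : norm_positive a -> norm_positive b -> norm_positive (a + b).
Proof.
move=> [sa [r r0 ra]] [sb [q q0 qb]]; split; first by rewrite (bstarD BB) sa sb.
exists (r + q); first exact: addr_gt0.
rewrite real_complexD scalerDl opprD addrACA (le_trans (bnormD BB _ _)) //.
exact: lerD.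
Qed.

Lemma norm_positiveZ r a : 0 < r -> norm_positive a -> norm_positive (r%:C *: a).
Proof.
move=> r0 [sa [q q0 qa]]; split; first by rewrite ucstarRZ sa.
exists (r * q); first exact: mulr_gt0.
rewrite real_complexM -scalerA -scalerBr (ucnormRZ _ (ltW r0)).
by rewrite ler_wpM2l // ltW.
Qed.

(** With c the square root of r - s^2, one has c^2 + s^2 = r, and
    [norm_le_sqr_sum] bounds c. *)
Lemma dist_sqr_le s r : st s = s -> N s ^+ 2 < r -> N (r%:C *: 1 - s * s) <= r.
Proof.
move=> ss sr; have r0 : 0 < r by apply: le_lt_trans sr; rewrite sqr_ge0.
pose a := r%:C *: 1 - s * s.
have [|||c [_ [cc _ _ sc cz]]] := @near_scalar_sqrt a r.
- by rewrite (bstarB BB) ucstar_real (bstarM BB) ss.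
- by [].
- by rewrite opprB addrC subrK (le_lt_trans (bnormM BB s s)).
have csC : c * s = s * c.
  by rewrite cz // mulrBr mulrBl commuteZ1 mulrA.
rewrite -/a -cc (le_trans (bnormM BB c c)) // -expr2.
by apply: (@norm_le_sqr_sum c s) => //; rewrite ?cc ?subrK // ltW.
Qed.

Lemma norm_positive_sqr s : st s = s -> norm_positive (s * s).
Proof.
move=> ss; have s0 : 0 < N s ^+ 2 + 1 by rewrite ltr_wpDl ?sqr_ge0.
split; first by rewrite (bstarM BB) ss.
by exists (N s ^+ 2 + 1) => //; apply: dist_sqr_le; rewrite // ltrDl.
Qed.

(** The order relation s^2 <= m controls the norm: m + e - s^2 is a square for
    every e > 0, and [norm_le_sqr_sum] applies. *)
Lemma norm_sqr_le s m : st s = s -> 0 <= m -> norm_positive (m%:C *: 1 - s * s) -> N s ^+ 2 <= m.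
Proof.
move=> ss m0 [_ [r r0 mr]]; rewrite -subr_le0; apply: (@le0_eps _ _ 1) => e e0.
have [|||c [_ [cc _ _ sc cz]]] := @near_scalar_sqrt ((m + e)%:C *: 1 - s * s) (r + e).
- by rewrite (bstarB BB) ucstar_real (bstarM BB) ss.
- exact: addr_gt0.
- suff -> : (r + e)%:C *: 1 - ((m + e)%:C *: 1 - s * s) =
            r%:C *: 1 - (m%:C *: 1 - s * s) by lra.
  by rewrite !real_complexD !scalerDl !opprB opprD (addrA (s * s)) addrACA subrr addr0.
have csC : c * s = s * c.
  by rewrite cz // mulrBr mulrBl commuteZ1 mulrA.
suff : N s ^+ 2 <= m + e by lra.
apply: (@norm_le_sqr_sum s c) => //; rewrite ?cc; last by lra.
by rewrite addrC subrK.
Qed.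

(** Put z = k x. Since k x x^* = 1 - r k, both 1/4 - r z z^* and 1/4 - r z^* z
    are squares, of s = 1/2 - r k and of t = 1/2 - x^* k x. Expressing
    z z^* + z^* z by the real and imaginary parts of z shows that 1/2 - s^2 is
    a sum of squares of self-adjoint elements, so N s < 1. This is the a
    priori bound that lets r decrease in [has_inverse_sqrt_shrink]. *)
Lemma resolvent_bound x k r : 0 < r ->
  k * (r%:C *: 1 + x * st x) = 1 -> (r%:C *: 1 + x * st x) * k = 1 ->
  N (r%:C *: k) <= 3 / 2.
Proof.
move=> r0; set a := _ + _ => ka ak; set y := st x in a ka ak *.
have sy : st y = x by rewrite /y (ucstarK BC).
have sa : st a = a by rewrite (bstarD BB) ucstar_real (bstarM BB) sy.
have sk : st k = k.
  have h : st k * a = 1 by rewrite -[a in LHS]sa -(bstarM BB) ak (bstar1 BB).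
  by rewrite -[st k]mulr1 -ak mulrA h mul1r.
pose hf : B := (1 / 2)%:C *: 1.
pose s := hf - r%:C *: k; pose t := hf - y * k * x.
pose z := k * x; have sz : st z = y * k by rewrite (bstarM BB) sk.
have shf : st hf = hf by rewrite ucstar_real.
have ss : st s = s by rewrite (bstarB BB) shf ucstarRZ sk.
have stt : st t = t.
  by rewrite (bstarB BB) shf !(bstarM BB) sk -/y sy mulrA.
have hfD w : hf * w + hf * w = w.
  rewrite -mulrDl -scalerDl -real_complexD.
  by rewrite (_ : 1 / 2 + 1 / 2 = 1 :> R) ?scale1r ?mul1r //; lra.
have hfE w : hf * hf - (hf - w) * (hf - w) = w - w * w.
  rewrite mulrBr !mulrBl (commuteZ1 _ w) -/hf !opprB addrC -addrA subrK.
  by rewrite addrAC hfD.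
have kxyk : k * x * y * k = k - r%:C *: (k * k).
  have xy : x * y = a - r%:C *: 1 by rewrite /a (addrC _ (x * y)) addrK.
  by rewrite -(mulrA k) xy mulrBr mulrBl ka mul1r -!scalerAr -!scalerAl mulr1.
have s2 : hf * hf - s * s = r%:C *: (z * st z).
  by rewrite hfE sz mulrA kxyk -scalerAl -scalerAr scalerBr.
have t2 : hf * hf - t * t = r%:C *: (st z * z).
  rewrite hfE sz /z.
  have -> : y * k * x * (y * k * x) = y * (k * x * y * k) * x by rewrite !mulrA.
  by rewrite kxyk mulrBr mulrBl opprB addrC subrK -!scalerAr -scalerAl !mulrA.
pose p := z + st z; pose q := 'i%C *: (st z - z).
have sp : st p = p by rewrite (bstarD BB) (ucstarK BC) addrC.
have sq : st q = q.
  by rewrite (ucstarZ BC) (bstarB BB) (ucstarK BC) conj_i scaleNr -scalerN opprB.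
have pq : p * p + q * q = (z * st z + st z * z) + (z * st z + st z * z).
  rewrite /q -scalerAl -scalerAr scalerA mul_ii scaleN1r /p.
  have -> : (z + st z) * (z + st z) = (st z * z + z * z) + (z * st z + st z * st z).
    by rewrite mulrDr !mulrDl [z * z + _]addrC.
  have -> : (st z - z) * (st z - z) = (st z * st z - z * st z) - (st z * z - z * z).
    by rewrite mulrBr !mulrBl.
  have zD (v w : B) : (v + w) + (v - w) = v + v by rewrite addrACA subrr addr0.
  by rewrite !opprB addrACA !zD [RHS]addrACA addrC.
have [] : N s ^+ 2 <= 1 / 2 /\ N (r%:C *: k) <= 1 / 2 + N s.
  split; last first.
    have -> : r%:C *: k = hf - s by rewrite opprB addrC subrK.
    by rewrite (le_trans (bnormB BB _ _)) // lerD2r ucnorm_real_le.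
  apply: norm_sqr_le => //.
  have -> : (1 / 2)%:C *: 1 - s * s = t * t + (r / 2)%:C *: (p * p + q * q).
    rewrite real_complexM -scalerA pq scalerDr -scalerDl -real_complexD.
    rewrite (_ : 2^-1 + 2^-1 = 1 :> R); last by lra.
    rewrite scale1r scalerDr -s2 -t2 addrCA (addrC (t * t)) subrK addrAC.
    by rewrite hfD.
  apply: norm_positiveD; first exact: norm_positive_sqr.
  apply: norm_positiveZ; first by rewrite divr_gt0.
  by apply: norm_positiveD; apply: norm_positive_sqr.
by have := bnorm_ge0 BB s; nra.
Qed.

(** The property that is propagated from large r down to all r > 0: the element
    r + x x^* is an invertible square. *)
Definition has_inverse_sqrt x r :=
  exists d d', [/\ d * d = r%:C *: 1 + x * st x, d * d' = 1, d' * d = 1 & st d = d].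

Lemma has_inverse_sqrt_large x : has_inverse_sqrt x (N (x * st x) + 1).
Proof.
have h0 := bnorm_ge0 BB (x * st x).
have [|||d [d' [dd dd' d'd sd _]]] := @near_scalar_sqrt
  ((N (x * st x) + 1)%:C *: 1 + x * st x) (N (x * st x) + 1).
- by rewrite (bstarD BB) ucstar_real (bstarM BB) (ucstarK BC).
- by rewrite ltr_wpDl.
- by rewrite opprD addrA subrr add0r (bnormN BB) ltrDl.
by exists d, d'.
Qed.

(** One has r 2/3 + x x^* = (r + x x^* ) (1 - (r/3) k) with k the inverse of
    r + x x^*, and [resolvent_bound] makes the second factor invertible with a
    square root. *)
Lemma has_inverse_sqrt_shrink x r : 0 < r ->
  has_inverse_sqrt x r -> has_inverse_sqrt x (r * (2 / 3)).
Proof.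
move=> r0 [d [d' [dd dd' d'd sd]]]; pose k := d' * d'.
have sd' : st d' = d'.
  have h : st d' * d = 1 by rewrite -[d in LHS]sd -(bstarM BB) dd' (bstar1 BB).
  by rewrite -[st d']mulr1 -dd' mulrA h mul1r.
have ddk : d * d * k = 1 by rewrite /k mulrA -(mulrA d) dd' mulr1 dd'.
have kdd : k * (d * d) = 1 by rewrite /k mulrA -(mulrA d') d'd mulr1 d'd.
have dk : d * k = k * d by rewrite /k mulrA dd' mul1r -mulrA d'd mulr1.
have kN : N (r%:C *: k) <= 3 / 2 by apply: (@resolvent_bound x); rewrite -?dd.
have [|||c [c' [cc cc' c'c sc cz]]] := @near_scalar_sqrt (1 - (r / 3)%:C *: k) 1.
- by rewrite (bstarB BB) (bstar1 BB) ucstarRZ /k (bstarM BB) sd'.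
- by [].
- rewrite scale1r opprB addrC subrK mulrC real_complexM -scalerA ucnormRZ ?invr_ge0 //.
  by lra.
have dc : d * c = c * d.
  by apply: cz; rewrite mulrBr mulrBl mulr1 mul1r -scalerAl -scalerAr dk.
exists (d * c), (c' * d'); split.
- rewrite {2}dc mulrA -(mulrA d) cc mulrBr mulrBl mulr1 -scalerAr -scalerAl.
  rewrite -mulrA -dk mulrA ddk dd addrAC -scalerBl; congr (_ *: _ + _).
  by rewrite -rmorphB; congr (_%:C); field.
- by rewrite mulrA -(mulrA d) cc' mulr1 dd'.
- by rewrite mulrA -(mulrA c') d'd mulr1 c'c.
- by rewrite (bstarM BB) sc sd dc.
Qed.

(** By [dist_sqr_le], r + x x^* is norm-positive with controlled constants for
    arbitrarily small r > 0; let r tend to 0. *)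
Lemma norm_positive_mul_star x : norm_positive (x * st x).
Proof.
have sh : st (x * st x) = x * st x by rewrite (bstarM BB) (ucstarK BC).
split=> //; set h := x * st x in sh *; have h0 := bnorm_ge0 BB h.
exists (N h + 1); first by rewrite ltr_wpDl.
have h10 : 0 < N h + 1 by rewrite ltr_wpDl.
(* The scale reached after n applications of has_inverse_sqrt_shrink. *)
pose r n : R := (N h + 1) * (2 / 3) ^+ n.
have r0 n : 0 < r n by rewrite mulr_gt0 // exprn_gt0.
have G n : has_inverse_sqrt x (r n).
  elim: n => [|n IH]; first by rewrite /r expr0 mulr1; exact: has_inverse_sqrt_large.
  by rewrite /r exprSr (mulrA _ (_ ^+ n)); exact: has_inverse_sqrt_shrink (r0 n) IH.
rewrite -subr_le0; apply: (@le0_eps _ _ (N h + 1)) => e e0.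
have [||n /(_ n (leqnn _)) re] := @expr_small R (2 / 3) e; [by lra | by [] |].
have {}re : r n <= (N h + 1) * e by rewrite /r ler_wpM2l // ltW.
have [d [_ [dd _ _ sd]]] := G n.
have dN : N d ^+ 2 < r n + (N h + 1).
  apply: (le_lt_trans (ucnorm_star_mul BC d)); rewrite sd dd.
  apply: (le_lt_trans (bnormD BB _ _)).
  by have := ucnorm_real_le (ltW (r0 n)); rewrite -/h; lra.
have := dist_sqr_le sd dN; rewrite dd real_complexD scalerDl opprD addrACA subrr add0r.
by lra.
Qed.

Lemma norm_positive_invertible a m : norm_positive a -> 0 < m -> invertible (a + m%:C *: 1).
Proof.
move=> [sa [r r0 ra]] m0.
have [|||c [c' [cc cc' c'c _ _]]] := @near_scalar_sqrt (m%:C *: 1 + a) (r + m).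
- by rewrite (bstarD BB) ucstar_real sa.
- exact: addr_gt0.
- rewrite real_complexD scalerDl opprD addrA addrK.
  by apply: le_lt_trans ra _; rewrite ltrDl.
exists (c' * c'); rewrite addrC -cc; split.
  by rewrite mulrA -(mulrA c) cc' mulr1 cc'.
by rewrite mulrA -(mulrA c') c'c mulr1 c'c.
Qed.

(** The factors s - i r and s + i r commute, and their product s^2 + r^2 is
    invertible. *)
Lemma self_adjoint_invertible s r : st s = s -> r != 0 ->
  invertible (s - (r%:C * 'i%C) *: 1).
Proof.
move=> ss r0; set w := (_ * _) *: 1.
have [||j [j1 j2]] := @norm_positive_invertible (s * s) (r ^+ 2).
- exact: norm_positive_sqr.
- by rewrite lt_neqAle sqr_ge0 eq_sym sqrf_eq0 r0.
have ww : w * w = - ((r ^+ 2)%:C *: 1).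
  rewrite /w -scalerAl -scalerAr scalerA mulr1 mulrACA mul_ii mulrN1 scaleNr.
  by rewrite -real_complexM.
have e1 : (s - w) * (s + w) = s * s + (r ^+ 2)%:C *: 1.
  by rewrite mulrDr !mulrBl ww opprK commuteZ1 addrA subrK.
have e2 : (s + w) * (s - w) = s * s + (r ^+ 2)%:C *: 1.
  by rewrite mulrBr !mulrDl ww commuteZ1 opprD opprK addrA addrK.
have l1 : (s - w) * ((s + w) * j) = 1 by rewrite mulrA e1.
have l2 : (j * (s + w)) * (s - w) = 1 by rewrite -mulrA e2.
exists ((s + w) * j); split=> //.
suff -> : (s + w) * j = j * (s + w) by [].
by rewrite -[RHS]mulr1 -l1 (mulrA (j * _)) l2 mul1r.
Qed.

Lemma norm_positive_spectrum a (l : C) : norm_positive a -> ~~ (0 <= l) ->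
  invertible (a - l *: 1).
Proof.
move=> aP l0; have [sa _] := aP; case: l l0 => lr li l0.
have -> : (lr +i* li)%C = lr%:C + li%:C * 'i%C.
  by apply/eqP; rewrite eq_complex /= !mul0r !mulr0 mulr1 !subr0 !addr0 add0r !eqxx.
have [li0|li0] := eqVneq li 0.
  rewrite li0 mul0r addr0; have lr0 : 0 < - lr.
    by rewrite oppr_gt0 ltNge; apply: contra l0; rewrite li0 => lr0; rewrite lecE /= eqxx.
  by have := norm_positive_invertible aP lr0; rewrite rmorphN scaleNr.
rewrite scalerDl opprD addrA; apply: self_adjoint_invertible => //.
by rewrite (bstarB BB) ucstar_real sa.
Qed.

Lemma norm_lt_invertible x (l : C) : N x < complex.Re `|l| -> invertible (x - l *: 1).
Proof.
move=> xl; have l0 : l != 0.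
  by apply/eqP => l0; move: xl; rewrite l0 normr0 ltNge (bnorm_ge0 BB).
have [|j [j1 j2]] := @neumann_inverse _ _ _ _ BB (l^-1 *: x).
  rewrite (ucnormZ BC); have : complex.Re `|l^-1| * complex.Re `|l| = 1.
    have := congr1 (@complex.Re R) (normrM l^-1 l).
    by rewrite mulVf // normr1 !normc_def /= !mulr0 subr0 => ->.
  have : 0 <= complex.Re `|l^-1| by rewrite normc_def /= sqrtr_ge0.
  have := bnorm_ge0 BB x; nra.
have xE : x - l *: 1 = (- l) *: (1 - l^-1 *: x).
  by rewrite scalerBr scalerA mulNr divff // scaleN1r opprK addrC scaleNr.
exists ((- l)^-1 *: j); rewrite xE; split.
  by rewrite -scalerAl -scalerAr scalerA j1 divff ?oppr_eq0 // scale1r.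
by rewrite -scalerAl -scalerAr scalerA j2 mulVf ?oppr_eq0 // scale1r.
Qed.

(** Spectral mapping for X (m - X): over the complex numbers m b - b^2 - l
    factors as - (b - u) (b - v) with u + v = m and u v = l. If u were in
    [0, m], then v would be too and l = u v >= 0; if u > m >= N b, then b - u is
    invertible by the Neumann series. *)
Lemma quadratic_spectrum b m (l : C) : N b <= m ->
  (forall l : C, ~~ (0 <= l) -> invertible (b - l *: 1)) ->
  ~~ (0 <= l) -> invertible (m%:C *: b - b * b - l *: 1).
Proof.
move=> bm bP l0; pose d := sqrtc (m%:C ^+ 2 - 4 * l).
pose u := (m%:C + d) / 2; pose v := (m%:C - d) / 2.
have uvD : u + v = m%:C by rewrite /u /v; field.
have uvM : u * v = l.
  have -> : u * v = (m%:C ^+ 2 - d ^+ 2) / 4 by rewrite /u /v; field.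
  by rewrite /d sqr_sqrtc; field.
have root w w' : w + w' = m%:C -> w * w' = l -> invertible (b - w *: 1).
  move=> wD wM; have [w0|/bP//] := boolP (0 <= w).
  have [|bw] := ltP (N b) (complex.Re `|w|); first exact: norm_lt_invertible.
  case/negP: l0; rewrite -wM mulr_ge0 // -(addKr w w') wD addrC subr_ge0.
  by rewrite -(RRe_real (ger0_real w0)) lecR -[w]ger0_norm // (le_trans bw).
have [j [j1 j2]] := root _ _ uvD uvM.
have [k [k1 k2]] : invertible (b - v *: 1) by apply: (root v u); rewrite 1?addrC 1?mulrC.
have -> : m%:C *: b - b * b - l *: 1 = - ((b - u *: 1) * (b - v *: 1)).
  rewrite -uvD -uvM -scalerA mulrBr !mulrBl -!scalerAl -!scalerAr !mul1r mulr1 scalerA.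
  rewrite scalerDl !opprB [RHS]addrACA -[LHS]addrA; congr (_ + _).
    by rewrite addrC.
  by rewrite addrC.
exists (- (k * j)); rewrite !mulrNN; split.
  by rewrite mulrA -(mulrA (b - _)) k1 mulr1 j1.
by rewrite mulrA -(mulrA k) j2 mulr1 k2.
Qed.

End UnitalCStar.

Arguments norm_positive {R B} st N a.

(** * The unitization as a unital C*-algebra *)

Section RealNorm.
Context {R : realType}.

(** Norms take values in R[i]; this is the same number seen in R. *)
Definition rnorm (V : normedZmodType R[i]) (x : V) : R := complex.Re `|x|.

Context {V : normedZmodType R[i]}.
Implicit Types x y : V.

Lemma rnormE x : `|x| = (rnorm x)%:C.
Proof. by rewrite /rnorm RRe_real // normr_real. Qed.

Lemma rnorm_ge0 x : 0 <= rnorm x.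
Proof. by rewrite -lecR -rnormE normr_ge0. Qed.

Lemma rnormD x y : rnorm (x + y) <= rnorm x + rnorm y.
Proof. by rewrite -lecR real_complexD -!rnormE ler_normD. Qed.

Lemma rnormN x : rnorm (- x) = rnorm x.
Proof. by rewrite /rnorm normrN. Qed.

Lemma rnorm0_eq0 x : rnorm x = 0 -> x = 0.
Proof. by move=> x0; apply/eqP; rewrite -normr_eq0 rnormE x0. Qed.

Lemma rnorm0 : rnorm (0 : V) = 0.
Proof. by rewrite /rnorm normr0. Qed.

End RealNorm.

Section ComplexNorm.
Context {R : realType}.
Implicit Types c d : R[i].

Lemma rnormM c d : rnorm (c * d) = rnorm c * rnorm d.
Proof. by apply: (@complexI R); rewrite real_complexM -!rnormE normrM. Qed.

Lemma rnormZ (V : normedModType R[i]) c (x : V) : rnorm (c *: x) = rnorm c * rnorm x.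
Proof. by apply: (@complexI R); rewrite real_complexM -!rnormE normrZ. Qed.

Lemma rnorm_conj c : rnorm (c^*) = rnorm c.
Proof. by rewrite /rnorm; congr complex.Re; exact: normcJ. Qed.

Lemma rnorm_real (r : R) : rnorm (r%:C : R[i]) = `|r|.
Proof. by apply: (@complexI R); rewrite -rnormE normc_def /= expr0n addr0 sqrtr_sqr. Qed.

Lemma rnorm1 : rnorm (1 : R[i]) = 1.
Proof. by rewrite (_ : 1 = 1%:C) // rnorm_real normr1. Qed.

Lemma Re_le_rnorm c : `|complex.Re c| <= rnorm c.
Proof. by rewrite -lecR -rnormE normc_ge_Re. Qed.

Lemma Im_le_rnorm c : `|complex.Im c| <= rnorm c.
Proof.
rewrite /rnorm normc_def /= -sqrtr_sqr ler_wsqrtr //.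
by rewrite lerDr sqr_ge0.
Qed.

Lemma rnorm_le_ReIm c : rnorm c <= `|complex.Re c| + `|complex.Im c|.
Proof.
rewrite {1}[c]complexE (le_trans (rnormD _ _)) // rnormM !rnorm_real.
by rewrite /rnorm norm_i mul1r.
Qed.

Lemma complete_real (u : nat -> R) : cauchy_seq (fun x : R => `|x|) u ->
  exists l, converges_to (fun x : R => `|x|) u l.
Proof.
move=> uc; have : cvg (u @ \oo).
  apply/cauchy_cvgP/cauchy_exP => e e0; have [n0 H] := uc _ (divr_gt0 e0 (ltr0n R 2)).
  exists (u n0), n0 => // n nn; rewrite -ball_normE /= (le_lt_trans (H _ _ _ nn)) //.
  by rewrite ltr_pdivrMr // ltr_pMr // ltr1n.
move/cvg_ex => [l ul]; exists l => e e0.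
by have /cvgrPdist_le/(_ _ e0)[n0 _ H] := ul; exists n0.
Qed.

Lemma complete_complex (u : nat -> R[i]) : cauchy_seq (@rnorm R R[i]) u ->
  exists l, converges_to (@rnorm R R[i]) u l.
Proof.
move=> uc.
have [|a ua] := @complete_real (fun n => complex.Re (u n)).
  move=> e /uc[n0 H]; exists n0 => m n mn nn.
  by rewrite (le_trans _ (H _ _ mn nn)) // (le_trans _ (Re_le_rnorm _)) // raddfB.
have [|b ub] := @complete_real (fun n => complex.Im (u n)).
  move=> e /uc[n0 H]; exists n0 => m n mn nn.
  by rewrite (le_trans _ (H _ _ mn nn)) // (le_trans _ (Im_le_rnorm _)) // raddfB.
exists (a +i* b)%C => e e0; have e20 : 0 < e / 2 by rewrite divr_gt0.
have [n0 H] := ua _ e20; have [n1 H1] := ub _ e20.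
exists (maxn n0 n1) => n; rewrite geq_max => /andP[/H Hn /H1 H1n].
rewrite (le_trans (rnorm_le_ReIm _)) // !raddfB /=; lra.
Qed.

Lemma complete_rnorm (V : completeNormedModType R[i]) (u : nat -> V) :
  cauchy_seq (@rnorm R V) u -> exists l, converges_to (@rnorm R V) u l.
Proof.
move=> uc; have : cvg (u @ \oo).
  apply/cauchy_cvgP/cauchy_exP => e e0.
  have eE : e = (complex.Re e)%:C by rewrite RRe_real // gtr0_real.
  have re0 : 0 < complex.Re e by rewrite -ltcR -eE.
  have [n0 H] := uc _ (divr_gt0 re0 (ltr0n R 2)).
  exists (u n0), n0 => // n nn; rewrite -ball_normE /= eE rnormE ltcR.
  by rewrite (le_lt_trans (H _ _ _ nn)) // ltr_pdivrMr // ltr_pMr // ltr1n.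
move/cvg_ex => [l ul]; exists l => e e0.
have ec0 : 0 < e%:C :> R[i] by rewrite ltcR.
have /cvgrPdist_le/(_ _ ec0)[n0 _ H] := ul; exists n0 => n nn.
by have := H n nn; rewrite rnormE lecR.
Qed.

End ComplexNorm.

Section Unitization.
Context {R : realType} (A : cstarAlgType R).

(** An alias of the product, so that the ring structure of the unitization does
    not interfere with the componentwise one. The copy R[i]^o carries scalar
    multiplication over R[i]. *)
Definition unitz := (A * (R[i])^o)%type.
HB.instance Definition _ := GRing.Lmodule.on unitz.

Definition umul (x y : unitz) : unitz := unitization_mul x y.
Definition uone : unitz := (0, 1).

Lemma umulA : associative umul.
Proof.
move=> [a r] [b s] [c t]; rewrite /umul /unitization_mul /=; congr (_, _); last exact: mulrA.
rewrite !cmulDl !cmulDr !scalerDr !cmulZl !cmulZr !scalerA cmulA.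
rewrite !addrA [LHS](ACl (1*3*5*2*4*6*7)) /= [t * s]mulrC [t * r]mulrC.
by [].
Qed.

Lemma umul1 : left_id uone umul.
Proof.
by move=> [a r]; rewrite /umul /unitization_mul /= cmul0l add0r scaler0 add0r scale1r mul1r.
Qed.
Lemma umulr1 : right_id uone umul.
Proof.
by move=> [a r]; rewrite /umul /unitization_mul /= cmul0r add0r scaler0 addr0 scale1r mulr1.
Qed.
Lemma umulDl : left_distributive umul +%R.
Proof.
move=> [a r] [b s] [c t]; rewrite /umul /unitization_mul /=; congr (_, _); last exact: mulrDl.
rewrite cmulDl scalerDr scalerDl.
by rewrite [RHS]addrACA; congr (_ + _); exact: addrACA.
Qed.
Lemma umulDr : right_distributive umul +%R.
Proof.
move=> [a r] [b s] [c t]; rewrite /umul /unitization_mul /=; congr (_, _); last exact: mulrDr.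
rewrite cmulDr scalerDr scalerDl.
by rewrite [RHS]addrACA; congr (_ + _); exact: addrACA.
Qed.
Lemma uone_neq0 : uone != 0.
Proof. by apply/eqP => -[/eqP]; rewrite oner_eq0. Qed.

HB.instance Definition _ :=
  GRing.Zmodule_isNzRing.Build unitz umulA umul1 umulr1 umulDl umulDr uone_neq0.

Lemma umulE (x y : unitz) : x * y = (cmul x.1 y.1 + y.2 *: x.1 + x.2 *: y.1, x.2 * y.2).
Proof. by []. Qed.

Lemma uscaleAl (c : R[i]) (x y : unitz) : c *: (x * y) = c *: x * y.
Proof.
rewrite !umulE; congr (_, _); last exact: mulrA.
by rewrite /= !scalerDr cmulZl !scalerA [y.2 * c]mulrC.
Qed.
HB.instance Definition _ := GRing.LSemiModule_isLSemiAlgebra.Build R[i] unitz uscaleAl.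

Lemma uscaleAr (c : R[i]) (x y : unitz) : c *: (x * y) = x * (c *: y).
Proof.
rewrite !umulE; congr (_, _); last exact: mulrCA.
by rewrite /= !scalerDr cmulZr !scalerA [x.2 * c]mulrC.
Qed.
HB.instance Definition _ := GRing.LSemiAlgebra_isSemiAlgebra.Build R[i] unitz uscaleAr.

Implicit Types (x y : unitz) (a b : A).

Definition ustar x : unitz := (cstar x.1, (x.2 : R[i])^*).
(** Left multiplication of the unitization on its ideal A. *)
Definition uact x a : A := cmul x.1 a + x.2 *: a.
Definition uinj a : unitz := (a, 0).
Definition uscalar x : R[i] := x.2.

Lemma uact_inj x a : x * uinj a = uinj (uact x a).
Proof. by rewrite umulE /uinj /uact /= scale0r addr0 mulr0. Qed.

Lemma uinjM a b : uinj (cmul a b) = uinj a * uinj b.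
Proof. by rewrite umulE /uinj /= !scale0r !addr0 mulr0. Qed.

Lemma uinjD a b : uinj (a + b) = uinj a + uinj b.
Proof. by congr (_, _); rewrite /= addr0. Qed.

Lemma uinjZ (c : R[i]) a : uinj (c *: a) = c *: uinj a.
Proof. by congr (_, _); rewrite /= scaler0. Qed.

Lemma uinj_inj : injective uinj.
Proof. by move=> a b []. Qed.

Lemma ustar_inj a : ustar (uinj a) = uinj (cstar a).
Proof. by congr (_, _); rewrite /= conjC0. Qed.

Lemma ustarK : involutive ustar.
Proof. by move=> [a r]; rewrite /ustar /= cstarK conjCK. Qed.

Lemma ustarD : {morph ustar : x y / x + y}.
Proof. by move=> [a r] [b s]; rewrite /ustar /= cstarD rmorphD. Qed.

Lemma ustarM x y : ustar (x * y) = ustar y * ustar x.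
Proof.
case: x y => [a r] [b s]; rewrite umulE /ustar umulE /=.
by rewrite !cstarD cstarM !cstarZ rmorphM mulrC addrAC.
Qed.

Lemma ustar1 : ustar 1 = 1.
Proof. by congr (_, _); rewrite /= ?cstar0 ?conjC1. Qed.

Lemma ustarZ (c : R[i]) x : ustar (c *: x) = c^* *: ustar x.
Proof. by case: x => [a r]; rewrite /ustar /= cstarZ rmorphM. Qed.

Lemma rnorm_cmul a b : rnorm (cmul a b) <= rnorm a * rnorm b.
Proof. by rewrite -lecR real_complexM -!rnormE norm_cmul. Qed.

Lemma rnorm_cstar_mul a : rnorm (cmul (cstar a) a) = rnorm a ^+ 2.
Proof. by apply: (@complexI R); rewrite rmorphXn /= -!rnormE norm_cstar_mul. Qed.

Lemma rnorm_cstar a : rnorm (cstar a) = rnorm a.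
Proof.
have le b : rnorm b <= rnorm (cstar b).
  have := rnorm_cmul (cstar b) b; rewrite rnorm_cstar_mul expr2.
  have := rnorm_ge0 b; rewrite le_eqVlt => /orP[/eqP <- _|b0]; first exact: rnorm_ge0.
  by rewrite ler_pM2r.
by apply/eqP; rewrite eq_le le andbT -{2}(cstarK a) le.
Qed.

(** The bound on the scalar part turns the operator seminorm into a norm:
    if A has a unit 1_A, then (1_A, -1) acts as 0 on A. *)
Definition ubound x : set R := [set m | [/\ 0 <= m, rnorm (uscalar x) <= m &
  forall a, rnorm (uact x a) <= m * rnorm a]].

Definition unorm x : R := inf (ubound x).

Lemma ubound_trivial x : ubound x (rnorm x.1 + rnorm (uscalar x)).
Proof.
split; rewrite ?addr_ge0 ?rnorm_ge0 ?lerDr ?rnorm_ge0 // => a.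
rewrite (le_trans (rnormD _ _)) // mulrDl lerD ?rnorm_cmul //.
by rewrite (@rnormZ R A) lexx.
Qed.

Lemma has_inf_ubound x : has_inf (ubound x).
Proof.
split; first by exists (rnorm x.1 + rnorm (uscalar x)); exact: ubound_trivial.
by exists 0 => m [].
Qed.

Lemma unorm_le x m : ubound x m -> unorm x <= m.
Proof. by apply: ge_inf; case: (has_inf_ubound x). Qed.

Lemma unorm_bound x : ubound x (unorm x).
Proof.
have [ne _] := has_inf_ubound x; split.
- by apply: lb_le_inf => // m [].
- by apply: lb_le_inf => // m [].
- move=> a; have := rnorm_ge0 a; rewrite le_eqVlt => /orP[/eqP a0|a0].
    have -> : a = 0 by apply: rnorm0_eq0.
    by rewrite /uact cmul0r scaler0 addr0 rnorm0 mulr0.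
  rewrite -ler_pdivrMr //; apply: lb_le_inf => // m [_ _ /(_ a)].
  by rewrite ler_pdivrMr.
Qed.

Lemma unorm_ge0 x : 0 <= unorm x. Proof. by case: (unorm_bound x). Qed.
Lemma unorm_scalar x : rnorm (uscalar x) <= unorm x. Proof. by case: (unorm_bound x). Qed.
Lemma unorm_act x a : rnorm (uact x a) <= unorm x * rnorm a.
Proof. by case: (unorm_bound x). Qed.

Lemma unorm_inj a : unorm (uinj a) <= rnorm a.
Proof. by have := unorm_le (ubound_trivial (uinj a)); rewrite rnorm0 addr0. Qed.

(** Apply x to the adjoint of its component in A and use the C*-identity; this
    reduces completeness of the unitization to that of A. *)
Lemma rnorm_fst x : rnorm x.1 <= 2 * unorm x.
Proof.
have := rnorm_ge0 x.1; rewrite le_eqVlt => /orP[/eqP <-|x0].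
  by rewrite mulr_ge0 ?unorm_ge0.
have e : cmul x.1 (cstar x.1) = uact x (cstar x.1) - x.2 *: cstar x.1 by rewrite addrK.
have := rnorm_cstar_mul (cstar x.1); rewrite cstarK e rnorm_cstar => e2.
have : rnorm x.1 ^+ 2 <= 2 * unorm x * rnorm x.1.
  rewrite -e2 (le_trans (rnormD _ _)) // rnormN (@rnormZ R A) rnorm_cstar.
  have := unorm_act x (cstar x.1); rewrite rnorm_cstar.
  have := unorm_scalar x; rewrite /uscalar; nra.
by rewrite expr2 ler_pM2r.
Qed.

Lemma unormD x y : unorm (x + y) <= unorm x + unorm y.
Proof.
apply: unorm_le; split; first by rewrite addr_ge0 ?unorm_ge0.
  by rewrite (le_trans (rnormD _ _)) // lerD ?unorm_scalar.
move=> a; have -> : uact (x + y) a = uact x a + uact y a.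
  by rewrite /uact /= cmulDl scalerDl addrACA.
by rewrite (le_trans (rnormD _ _)) // mulrDl lerD ?unorm_act.
Qed.

Lemma unormZ_le (c : R[i]) x : unorm (c *: x) <= rnorm c * unorm x.
Proof.
apply: unorm_le; split; first by rewrite mulr_ge0 ?rnorm_ge0 ?unorm_ge0.
  by rewrite [uscalar _]/(c * uscalar x) rnormM ler_wpM2l ?rnorm_ge0 ?unorm_scalar.
move=> a; have -> : uact (c *: x) a = c *: uact x a.
  by rewrite /uact /= cmulZl scalerDr scalerA.
by rewrite (@rnormZ R A) -mulrA ler_wpM2l ?rnorm_ge0 ?unorm_act.
Qed.

Lemma unormZ (c : R[i]) x : unorm (c *: x) = rnorm c * unorm x.
Proof.
apply/eqP; rewrite eq_le unormZ_le /=.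
have [->|c0] := eqVneq c 0; first by rewrite rnorm0 mul0r unorm_ge0.
have := unormZ_le c^-1 (c *: x); rewrite scalerA mulVf // scale1r => h.
have := ler_wpM2l (rnorm_ge0 c) h.
by rewrite mulrA -rnormM divff // rnorm1 mul1r.
Qed.

Lemma unormM x y : unorm (x * y) <= unorm x * unorm y.
Proof.
apply: unorm_le; split; first by rewrite mulr_ge0 ?unorm_ge0.
  rewrite [uscalar _]/(uscalar x * uscalar y) rnormM.
  by rewrite ler_pM ?rnorm_ge0 ?unorm_scalar.
move=> a; have -> : uact (x * y) a = uact x (uact y a).
  by apply: uinj_inj; rewrite -!uact_inj mulrA.
rewrite (le_trans (unorm_act _ _)) // -mulrA ler_wpM2l ?unorm_ge0 //.
exact: unorm_act.
Qed.

Lemma unorm0_eq0 x : unorm x = 0 -> x = 0.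
Proof.
move=> x0; have := rnorm_fst x; have := unorm_scalar x; rewrite x0 mulr0.
move=> s0 f0; case: x {x0} s0 f0 => a r /= s0 f0; congr (_, _).
  by apply: rnorm0_eq0; apply/eqP; rewrite eq_le f0 rnorm_ge0.
by apply: rnorm0_eq0; apply/eqP; rewrite eq_le s0 rnorm_ge0.
Qed.

(** The C*-identity of A gives |x a|^2 = |a^* (x^* x) a|, so the operator norm
    inherits it. *)
Lemma unorm_star_mul x : unorm x ^+ 2 <= unorm (ustar x * x).
Proof.
set m := unorm (_ * _); have m0 : 0 <= m by exact: unorm_ge0.
suff : unorm x <= Num.sqrt m.
  by move=> h; rewrite -[m]sqr_sqrtr // lerXn2r // nnegrE ?unorm_ge0 ?sqrtr_ge0.
apply: unorm_le; split; first exact: sqrtr_ge0.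
  rewrite -[rnorm _]ger0_norm ?rnorm_ge0 // -sqrtr_sqr ler_wsqrtr //.
  have := unorm_scalar (ustar x * x).
  by rewrite [uscalar _]/((uscalar x)^* * uscalar x) rnormM rnorm_conj expr2.
move=> a; have a0 := rnorm_ge0 a.
rewrite -[rnorm a]ger0_norm // -sqrtr_sqr -sqrtrM //.
rewrite -[rnorm (uact _ _)]ger0_norm ?rnorm_ge0 // -sqrtr_sqr ler_wsqrtr //.
rewrite -rnorm_cstar_mul.
have -> : cmul (cstar (uact x a)) (uact x a) = cmul (cstar a) (uact (ustar x * x) a).
  apply: uinj_inj; rewrite !uinjM -!ustar_inj -!uact_inj ustarM.
  by rewrite -!mulrA.
rewrite (le_trans (rnorm_cmul _ _)) // rnorm_cstar expr2 mulrCA ler_wpM2l //.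
exact: unorm_act.
Qed.

Lemma unorm_star x : unorm (ustar x) = unorm x.
Proof.
have le y : unorm y <= unorm (ustar y).
  have := le_trans (unorm_star_mul y) (unormM _ _); rewrite expr2.
  have := unorm_ge0 y; rewrite le_eqVlt => /orP[/eqP <- _|b0]; first exact: unorm_ge0.
  by rewrite ler_pM2r.
by apply/eqP; rewrite eq_le le andbT -{2}(ustarK x) le.
Qed.

Lemma unorm_complete (u : nat -> unitz) : cauchy_seq unorm u ->
  exists l, converges_to unorm u l.
Proof.
move=> uc.
have [|a ua] := @complete_rnorm _ A (fun n => (u n).1).
  move=> e e0; have [n0 H] := uc _ (divr_gt0 e0 (ltr0n R 2)); exists n0 => m n mn nn.
  by have := rnorm_fst (u m - u n); have := H _ _ mn nn; rewrite /=; lra.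
have [|b ub] := @complete_complex _ (fun n => uscalar (u n)).
  move=> e /uc[n0 H]; exists n0 => m n mn nn.
  exact: le_trans (unorm_scalar (u m - u n)) (H _ _ mn nn).
exists (a, b) => e e0; have e20 : 0 < e / 2 by rewrite divr_gt0.
have [n0 H] := ua _ e20; have [n1 H1] := ub _ e20.
exists (maxn n0 n1) => n; rewrite geq_max => /andP[/H Hn /H1 H1n].
rewrite (le_trans (unorm_le (ubound_trivial _))) //.
rewrite [uscalar _]/(b - uscalar (u n)) [_.1]/(a - (u n).1); lra.
Qed.

Lemma unitz_cstar : unital_cstar_algebra ustar unorm.
Proof.
have n1 : unorm 1 <= 1.
  apply: unorm_le; split; rewrite ?rnorm1 // => a.
  by rewrite /uact /= cmul0l add0r scale1r mul1r.
split; last exact: unorm_star_mul.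
- split.
  + exact: unorm_ge0.
  + exact: unormD.
  + by move=> x; rewrite -scaleN1r unormZ rnormN rnorm1 mul1r.
  + exact: unormM.
  + exact: unorm0_eq0.
  + exact: unorm_complete.
  + exact: ustarD.
  + exact: ustarM.
  + exact: ustar1.
  + exact: unorm_star.
  + exists ((1 / 2)%:C *: 1); split.
    * rewrite -scalerDl -real_complexD (_ : 1 / 2 + 1 / 2 = 1 :> R) ?scale1r //; lra.
    * by rewrite ustarZ ustar1 conj_real.
    * by move=> x; exact: (esym (commuteZ1 _ _)).
    * by move=> x; rewrite -scalerAl mul1r unormZ rnorm_real ger0_norm ?divr_ge0 // mul1r mulrC.
- exact: ustarK.
- exact: ustarZ.
- by move=> c x; rewrite unormZ.
- exact: n1.
Qed.

Lemma invertible_spectrum a (l : R[i]) : invertible (uinj a - l *: 1) <-> ~ spectrum a l.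
Proof.
have -> : uinj a - l *: 1 = (a, - l) :> unitz.
  by congr (_, _); rewrite /= ?scaler0 ?subr0 // sub0r [_ *: _]mulr1.
by split=> [[y [y1 y2]]|/contrapT[y [y1 y2]]]; [case; exists y | exists y].
Qed.

End Unitization.

(** * The right ideal of elements of finite weight *)

Section WeightFinite.
Context {R : realType} {A : cstarAlgType R}.
Implicit Types (a b x y z : A).
Local Notation NU := (@unorm R A).

Let UC := unitz_cstar A.
Let UB : banach_star_ring (@ustar R A) NU := UC.

Definition mulstar x : A := cmul x (cstar x).

Lemma uinj_mulstar x : uinj (mulstar x) = uinj x * ustar (uinj x).
Proof. by rewrite /mulstar uinjM ustar_inj. Qed.

Lemma positive_cone_norm_positive a :
  norm_positive (@ustar R A) NU (uinj a) -> positive_cone a.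
Proof.
move=> aP; split.
  by have [sa _] := aP; apply: uinj_inj; rewrite -ustar_inj.
move=> l al; apply: contrapT => /negP l0.
by apply: (invertible_spectrum a l).1 al; exact: (norm_positive_spectrum UC).
Qed.

Lemma norm_positive_sum_mulstar I (r : seq I) (F : I -> A) :
  norm_positive (@ustar R A) NU (uinj (\sum_(i <- r) mulstar (F i))).
Proof.
elim: r => [|i r IH].
  rewrite big_nil; have := norm_positive_mul_star UC 0.
  by rewrite mul0r.
rewrite big_cons uinjD; apply: (norm_positiveD UC); last exact: IH.
by rewrite uinj_mulstar; exact: (norm_positive_mul_star UC).
Qed.

Lemma positive_cone_sum_mulstar I (r : seq I) (F : I -> A) :
  positive_cone (\sum_(i <- r) mulstar (F i)).
Proof. exact/positive_cone_norm_positive/norm_positive_sum_mulstar. Qed.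

Lemma positive_cone_mulstar x : positive_cone (mulstar x).
Proof.
apply: positive_cone_norm_positive; rewrite uinj_mulstar.
exact: (norm_positive_mul_star UC).
Qed.

Lemma positive_coneZ_mulstar (r : R) x : 0 <= r -> positive_cone (r%:C *: mulstar x).
Proof.
move=> r0; suff -> : r%:C *: mulstar x = mulstar ((Num.sqrt r)%:C *: x).
  exact: positive_cone_mulstar.
rewrite /mulstar cstarZ cmulZl cmulZr scalerA conj_real -real_complexM.
by rewrite -expr2 sqr_sqrtr.
Qed.

Lemma mulstarD x y :
  mulstar (x + y) = (mulstar x + mulstar y) + (cmul x (cstar y) + cmul y (cstar x)).
Proof.
rewrite /mulstar cstarD cmulDl !cmulDr [cmul y _ + _]addrC.
by rewrite addrACA.
Qed.

Lemma mulstarB x y :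
  mulstar (x - y) = (mulstar x + mulstar y) - (cmul x (cstar y) + cmul y (cstar x)).
Proof.
rewrite mulstarD /mulstar -!(scaleN1r y) cstarZ rmorphN1 !cmulZl !cmulZr scalerA.
by rewrite mulrNN mulr1 scale1r !scaleN1r -opprD.
Qed.

Lemma mulstar_parallelogram x y :
  mulstar (x + y) + mulstar (x - y) = 2%:C *: mulstar x + 2%:C *: mulstar y.
Proof.
rewrite mulstarD mulstarB addrACA subrr addr0 -scalerDr.
by rewrite (_ : 2 = 1 + 1 :> R) // real_complexD scalerDl scale1r.
Qed.

Lemma mulstar_polarization x y : 4%:C *: cmul x (cstar y) =
  (mulstar (x + y) - mulstar (x - y)) +
  'i%C *: (mulstar (x + 'i%C *: y) - mulstar (x - 'i%C *: y)).
Proof.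
have d z : mulstar (x + z) - mulstar (x - z) =
    2%:C *: (cmul x (cstar z) + cmul z (cstar x)).
  rewrite mulstarD mulstarB opprB addrC addrA subrK.
  by rewrite (_ : 2 = 1 + 1 :> R) // real_complexD scalerDl scale1r.
have sC (w : A) : 'i%C *: (2%:C *: w) = 2%:C *: ('i%C *: w).
  by rewrite !scalerA mulrC.
rewrite !d sC cstarZ conj_i cmulZr cmulZl (scalerDr 'i%C) !(scalerA 'i%C).
rewrite mulrN mul_ii opprK scale1r scaleN1r -scalerDr addrACA subrr addr0.
rewrite (_ : 4 = 2 * 2 :> R); last by lra.
rewrite real_complexM -scalerA (_ : 2 = 1 + 1 :> R) // real_complexD.
by rewrite !scalerDl !scale1r.
Qed.

Context (psi : A -> \bar R) (wpsi : weight psi).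

Lemma weight_sum_mulstar I (r : seq I) (F : I -> A) :
  psi (\sum_(i <- r) mulstar (F i)) = (\sum_(i <- r) psi (mulstar (F i)))%E.
Proof.
elim: r => [|i r IH]; first by rewrite !big_nil (weight0 wpsi).
rewrite !big_cons (weightD wpsi) ?IH //; first exact: positive_cone_mulstar.
exact: positive_cone_sum_mulstar.
Qed.

Lemma weight_lt_pinfty a b : positive_cone a -> positive_cone b ->
  (psi (a + b)%R < +oo -> psi a < +oo)%E.
Proof.
move=> a0 b0; apply: le_lt_trans; rewrite (weightD wpsi) // leeDl //.
exact: (weight_ge0 wpsi).
Qed.

(** These elements form a right ideal, the adjoint of the left ideal of the
    Gelfand-Naimark-Segal construction for psi. *)
Definition finite_weight x := (psi (mulstar x) < +oo)%E.

(** With c^2 = m - z z^* one has (x z) (x z)^* + (x c) (x c)^* = m x x^*, and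
    x c lies in A because A is an ideal of its unitization. *)
Lemma finite_weightM x z : finite_weight x -> finite_weight (cmul x z).
Proof.
move=> xf; pose m := NU (uinj z) ^+ 2 + 1.
have z0 := unorm_ge0 (uinj z).
have m0 : 0 < m by rewrite ltr_wpDl ?sqr_ge0.
have [|||c [_ [cc _ _ sc _]]] :=
  @near_scalar_sqrt _ _ _ _ UC (m%:C *: 1 - uinj z * ustar (uinj z)) m.
- by rewrite (bstarB UB) (ucstar_real UC) ustarM ustarK.
- by [].
- rewrite opprB addrC subrK (le_lt_trans (unormM _ _)) // unorm_star /m -expr2.
  by rewrite ltrDl.
pose y := cstar (uact c (cstar x)).
have yE : uinj y = uinj x * c.
  by rewrite /y -ustar_inj -uact_inj ustarM sc ustar_inj cstarK.
apply: (@weight_lt_pinfty _ (mulstar y)); try exact: positive_cone_mulstar.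
have -> : mulstar (cmul x z) + mulstar y = m%:C *: mulstar x.
  apply: uinj_inj; rewrite uinjD uinjZ !uinj_mulstar yE uinjM !ustarM sc.
  rewrite !mulrA -(mulrA (uinj x) c) cc -(mulrA (uinj x) (uinj z)).
  rewrite mulrBr mulrBl -scalerAr -scalerAl mulr1.
  by rewrite addrC subrK.
rewrite (weightZ wpsi) ?ltW //; last exact: positive_cone_mulstar.
by rewrite lte_mul_pinfty // lee_fin ltW.
Qed.

Lemma finite_weightZ (c : R[i]) x : finite_weight x -> finite_weight (c *: x).
Proof.
rewrite /finite_weight => xf.
have -> : mulstar (c *: x) = (rnorm c ^+ 2)%:C *: mulstar x.
  rewrite /mulstar cstarZ cmulZl cmulZr scalerA rmorphXn /= -rnormE.
  by congr (_ *: _); rewrite sqr_normc.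
rewrite (weightZ wpsi) ?sqr_ge0 //; last exact: positive_cone_mulstar.
by rewrite lte_mul_pinfty // lee_fin sqr_ge0.
Qed.

(** The parallelogram law dominates (x + y) (x + y)^* by 2 x x^* + 2 y y^*. *)
Lemma finite_weightD x y : finite_weight x -> finite_weight y -> finite_weight (x + y).
Proof.
move=> xf yf; apply: (@weight_lt_pinfty _ (mulstar (x - y)));
  try exact: positive_cone_mulstar.
rewrite mulstar_parallelogram.
have fin z : finite_weight z -> (psi (2%:C *: mulstar z)%R < +oo)%E.
  move=> zf; rewrite (weightZ wpsi) //; last exact: positive_cone_mulstar.
  by rewrite lte_mul_pinfty.
rewrite (weightD wpsi) ?lte_add_pinfty ?fin //; exact: positive_coneZ_mulstar.
Qed.

Lemma finite_weight_sum I (r : seq I) (F : I -> A) :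
  (forall i, finite_weight (F i)) -> finite_weight (\sum_(i <- r) F i).
Proof.
move=> Ff; apply: (big_ind finite_weight) => //; last exact: finite_weightD.
by rewrite /finite_weight /mulstar cmul0l (weight0 wpsi).
Qed.

(** For positive b one has b^2 <= N(b) b, by [quadratic_spectrum]. *)
Lemma finite_weight_positive b : positive_cone b -> (psi b < +oo)%E -> finite_weight b.
Proof.
move=> bP bf; have [sb spb] := bP.
have bi (l : R[i]) : ~~ (0 <= l) -> invertible (uinj b - l *: 1).
  by move=> l0; apply/invertible_spectrum => /spb; apply/negP.
pose m := NU (uinj b).
have m0 : 0 <= m by exact: unorm_ge0.
have qP : positive_cone (m%:C *: b - mulstar b).
  split.
    rewrite cstarD -scaleN1r cstarZ cstarZ conj_real sb rmorphN1 scaleN1r.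
    by have [-> _] := positive_cone_mulstar b; rewrite scaleN1r.
  move=> l; apply: contraPP => /negP l0; apply/invertible_spectrum.
  have := quadratic_spectrum UC (lexx m) bi l0.
  by rewrite -uinjM -uinjZ -[- uinj _]scaleN1r -uinjZ -uinjD scaleN1r /mulstar sb.
apply: (@weight_lt_pinfty _ (m%:C *: b - mulstar b)) => //.
  exact: positive_cone_mulstar.
rewrite addrC subrK (weightZ wpsi) // lte_mul_pinfty //.
Qed.

Definition approximable a := forall e : R, 0 < e ->
  exists2 x, finite_weight x & rnorm (a - x) <= e.

Lemma approximableD a b : approximable a -> approximable b -> approximable (a + b).
Proof.
move=> aa bb e e0; have e20 : 0 < e / 2 by rewrite divr_gt0.
have [x xf ax] := aa _ e20; have [y yf yb] := bb _ e20.
exists (x + y); first exact: finite_weightD.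
by rewrite opprD addrACA (le_trans (rnormD _ _)) //; lra.
Qed.

Lemma approximableZ (c : R[i]) a : approximable a -> approximable (c *: a).
Proof.
move=> aa e e0; have c0 := rnorm_ge0 c.
have c1 : 0 < rnorm c + 1 by rewrite ltr_wpDl.
have [x xf ax] := aa _ (divr_gt0 e0 c1).
exists (c *: x); first exact: finite_weightZ.
rewrite -scalerBr (@rnormZ R A); move: ax; rewrite ler_pdivlMr // => ax.
have := rnorm_ge0 (a - x); nra.
Qed.

Lemma approximable_sum I (r : seq I) (F : I -> A) :
  (forall i, approximable (F i)) -> approximable (\sum_(i <- r) F i).
Proof.
move=> Ff; apply: (big_ind approximable) => //; last exact: approximableD.
move=> e e0; exists 0; last by rewrite subrr rnorm0 ltW.
by rewrite /finite_weight /mulstar cmul0l (weight0 wpsi).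
Qed.

Context (dpsi : densely_defined psi).

Lemma approximable_positive a : positive_cone a -> approximable a.
Proof.
move=> aP e e0; have ec0 : 0 < e%:C :> R[i] by rewrite ltcR.
have [b [[bP bf]]] := dpsi aP (nbhsx_ballx a _ ec0).
rewrite -ball_normE /= rnormE ltcR => /ltW ab.
by exists b => //; apply: finite_weight_positive.
Qed.

(** Polarization writes y z^* as a combination of four elements u u^*. *)
Lemma approximable_mul y z : approximable (cmul y (cstar z)).
Proof.
have mP x : approximable (mulstar x).
  by apply: approximable_positive; exact: positive_cone_mulstar.
have -> : cmul y (cstar z) = 4^-1%:C *: (4%:C *: cmul y (cstar z)).
  by rewrite scalerA -real_complexM mulVf // scale1r.
apply: approximableZ; rewrite mulstar_polarization -!(scaleN1r (mulstar _)).
apply: approximableD; first by apply: approximableD => //; apply: approximableZ.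
by apply: approximableZ; apply: approximableD => //; apply: approximableZ.
Qed.

End WeightFinite.

(** * Projections have equivalent projections of finite weight *)

Section MatrixBanach.
Context {R : realType} {B : pzRingType} {st : B -> B} {N : B -> R}.
Context (BB : banach_star_ring st N) (k : nat).
Implicit Types X Y : 'M[B]_k.

Definition mxstar X : 'M[B]_k := map_mx st X^T.
(** The sum of the norms of the entries is submultiplicative and complete, which
    is all that square roots need; it is not a C*-norm. *)
Definition mxnorm X : R := \sum_i \sum_j N (X i j).

Lemma entry_le_mxnorm X i j : N (X i j) <= mxnorm X.
Proof.
rewrite /mxnorm (bigD1 i) //= (bigD1 j) //= -addrA lerDl.
by rewrite addr_ge0 ?sumr_ge0 // => *; rewrite ?sumr_ge0 // => *; exact: bnorm_ge0 BB _.
Qed.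

Lemma bnorm_sum I (r : seq I) (F : I -> B) : N (\sum_(i <- r) F i) <= \sum_(i <- r) N (F i).
Proof.
elim: r => [|i r IH]; first by rewrite !big_nil (bnorm0 BB).
by rewrite !big_cons (le_trans (bnormD BB _ _)) // lerD2l.
Qed.

Lemma mxnormM X Y : mxnorm (X *m Y) <= mxnorm X * mxnorm Y.
Proof.
have N0 x := bnorm_ge0 BB x.
rewrite /mxnorm mulr_suml ler_sum // => i _.
apply: (@le_trans _ _ (\sum_j \sum_l N (X i l) * N (Y l j))).
  apply: ler_sum => j _; rewrite mxE (le_trans (bnorm_sum _ _)) //.
  by apply: ler_sum => l _; exact: bnormM BB _ _.
rewrite exchange_big mulr_suml; apply: ler_sum => l _ /=.
rewrite -mulr_sumr ler_wpM2l // [leRHS](bigD1 l) //= lerDl.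
by apply: sumr_ge0 => *; apply: sumr_ge0.
Qed.

Lemma mxnorm_le X (e : R) : (forall i j, N (X i j) <= e) -> mxnorm X <= (k * k)%:R * e.
Proof.
move=> Xe; rewrite /mxnorm; apply: (@le_trans _ _ (\sum_(i < k) \sum_(j < k) e)).
  by apply: ler_sum => i _; apply: ler_sum => j _.
by rewrite !sumr_const !card_ord -mulrnA mulr_natl.
Qed.

Lemma matrix_banach_star_ring : banach_star_ring mxstar mxnorm.
Proof.
have N0 x := bnorm_ge0 BB x.
split.
- by move=> X; apply: sumr_ge0 => i _; apply: sumr_ge0.
- move=> X Y; rewrite /mxnorm -big_split ler_sum // => i _.
  by rewrite -big_split ler_sum // => j _; rewrite mxE (bnormD BB).
- move=> X; apply: eq_bigr => i _; apply: eq_bigr => j _.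
  by rewrite mxE (bnormN BB).
- exact: mxnormM.
- move=> X X0; apply/matrixP => i j; rewrite mxE; apply: (bnorm0_eq0 BB).
  by apply/eqP; rewrite eq_le N0 -{1}X0 entry_le_mxnorm.
- move=> u uc.
  have /boolp.choice[l ul] (ij : 'I_k * 'I_k) :
      exists l, converges_to N (fun n => u n ij.1 ij.2) l.
    apply: (bnorm_complete BB) => e /uc[n0 H]; exists n0 => m n mn nn.
    apply: le_trans (H m n mn nn).
    by have := entry_le_mxnorm (u m - u n) ij.1 ij.2; rewrite !mxE.
  exists (\matrix_(i, j) l (i, j)) => e e0.
  have k0 : 0 < (k * k)%:R + 1 :> R by rewrite ltr_wpDl.
  have e'0 : 0 < e / ((k * k)%:R + 1) by rewrite divr_gt0.
  have /boolp.choice[n0 H] (ij : 'I_k * 'I_k) := ul ij _ e'0.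
  exists (\max_ij n0 ij) => n nn.
  apply: (@le_trans _ _ ((k * k)%:R * (e / ((k * k)%:R + 1)))).
    apply: mxnorm_le => i j; rewrite !mxE.
    by apply: (H (i, j)); apply: leq_trans nn; exact: leq_bigmax.
  by rewrite mulrA ler_pdivrMr // mulrC ler_wpM2l ?lerDl // ltW.
- by move=> X Y; apply/matrixP => i j; rewrite !mxE (bstarD BB).
- have st_sum I (r : seq I) (F : I -> B) : st (\sum_(i <- r) F i) = \sum_(i <- r) st (F i).
    apply: (big_morph _ (bstarD BB)).
    by have := bstarB BB 0 0; rewrite !subrr.
  move=> X Y; apply/matrixP => i j; rewrite !mxE st_sum.
  by apply: eq_bigr => l _; rewrite !mxE (bstarM BB).
- apply/matrixP => i j; rewrite !mxE eq_sym; case: eqP => _; first exact: bstar1 BB.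
  by have := bstarB BB 0 0; rewrite !subrr.
- move=> X; rewrite /mxnorm exchange_big; apply: eq_bigr => i _; apply: eq_bigr => j _.
  by rewrite !mxE (bnorm_star BB).
- have [h [hh hs hC hN]] := bhalf BB.
  have hM X : h%:M *m X = \matrix_(i, j) (h * X i j).
    by rewrite mul_scalar_mx; apply/matrixP => i j; rewrite !mxE.
  exists h%:M; split.
  + by apply/matrixP => i j; rewrite !mxE -mulrnDl hh.
  + apply/matrixP => i j; rewrite !mxE eq_sym; case: eqP => _; first by [].
    by have := bstarB BB 0 0; rewrite !subrr.
  + move=> X; rewrite [LHS]hM; apply/matrixP => i j; rewrite !mxE (bigD1 j) //=.
    rewrite mxE eqxx hC big1 ?addr0 // => l lj.
    by rewrite mxE (negbTE lj) mulr0.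
  + move=> X; rewrite [X in mxnorm X]hM /mxnorm mulr_suml ler_sum // => i _.
    by rewrite mulr_suml ler_sum // => j _; rewrite mxE.
Qed.

End MatrixBanach.

Section NearProjection.
Context {R : realType} {B : pzRingType} {st : B -> B} {N : B -> R}.
Context (BB : banach_star_ring st N).
Implicit Types e x y d : B.

Lemma idempotent_compress e x y : e * e = e ->
  e - (e * (y + e)) * ((x + e) * e) = - (e * (x + y + y * x) * e).
Proof.
move=> ee; have -> : (e * (y + e)) * ((x + e) * e) =
    e * y * x * e + e * y * e + (e * x * e + e).
  by rewrite mulrDr mulrDl (mulrDl x) ee !mulrDr ee !mulrA.
rewrite !mulrDr !mulrDl !mulrA addrA opprD addrCA subrr addr0; congr (- _).
by rewrite addrC (addrC (e * y * x * e)) addrA.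
Qed.

(** A crude sufficient threshold: for N d <= eta <= 1/4 the middle factor has
    norm at most 3 eta, and 3 N(e)^2 eta = 1 - 4 eta. *)
Lemma norm_compress_lt1 e d : N d <= (3 * N e ^+ 2 + 4)^-1 ->
  N (e * (d + st d + st d * d) * e) < 1.
Proof.
set eta := _^-1 => dn; have m0 := bnorm_ge0 BB e; have D0 := bnorm_ge0 BB d.
have eta0 : 0 < eta by rewrite invr_gt0; nra.
have etam : eta * (3 * N e ^+ 2 + 4) = 1 by rewrite mulVf // gt_eqF //; nra.
have := bnormM BB (st d) d; rewrite (bnorm_star BB) => sdd.
have := bnormD BB d (st d); rewrite (bnorm_star BB) => dsd.
have dsdd := bnormD BB (d + st d) (st d * d).
have le1 := bnormM BB e (d + st d + st d * d).
apply: (le_lt_trans (bnormM BB _ _)).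
move: (N (e * _)) (N (_ + _ + _)) le1 dsdd => b a ba adf.
move: (N (_ + _)) (N (_ * _)) adf dsd sdd => f g afg fD gD.
move: (N e) m0 eta0 etam ba => m m0 eta0 etam ba.
have eta4 : eta <= 1 / 4 by have := mulr_ge0 (ltW eta0) (sqr_ge0 m); lra.
have gD' : g <= N d by apply: (le_trans gD); rewrite ler_piMr //; lra.
have a3 : a <= 3 * eta by lra.
have bm : b * m <= m * (3 * eta) * m.
  by rewrite ler_wpM2r // (le_trans ba) // ler_wpM2l.
have : m * (3 * eta) * m = 1 - 4 * eta by lra.
by lra.
Qed.

(** The element 1 - u = 1 - e + e x^* x e is near 1 and commutes with e; c is
    the inverse of its square root, so that x e c is the isometric part in the
    polar decomposition of x e. *)
Lemma isometry_near_projection e x : e * e = e -> st e = e -> st (st x) = x ->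
  N (x - e) <= (3 * N e ^+ 2 + 4)^-1 ->
  exists c, e * c = c * e /\ st (x * (e * c)) * (x * (e * c)) = e.
Proof.
move=> ee se sx xe; pose u := e - e * st x * x * e.
have u1 : N u < 1.
  have -> : u = - (e * ((x - e) + st (x - e) + st (x - e) * (x - e)) * e).
    have sxe : st (x - e) + e = st x by rewrite -{2}se -(bstarD BB) subrK.
    by rewrite -idempotent_compress // subrK sxe /u !mulrA.
  by rewrite (bnormN BB) norm_compress_lt1.
have us : st u = u by rewrite (bstarB BB) !(bstarM BB) se sx !mulrA.
have eu : e * u = u by rewrite /u mulrBr ee !mulrA ee.
have ue : u * e = u by rewrite /u mulrBl ee -(mulrA _ e e) ee.
have [c [c' [cc cc' c'c sc cz]]] := near_one_sqrt BB u1 us.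
have ec : e * c = c * e by apply: cz; rewrite eu ue.
have ec' : e * c' = c' * e.
  by rewrite -[LHS]mul1r -c'c -(mulrA c') (mulrA c) -ec -!mulrA cc' mulr1.
have sc' : st c' = c'.
  have h : st c' * c = 1 by rewrite -[c in LHS]sc -(bstarM BB) cc' (bstar1 BB).
  by rewrite -[st c']mulr1 -cc' mulrA h mul1r.
exists c'; split=> //; rewrite !(bstarM BB) sc' se.
have -> : c' * e * st x * (x * (e * c')) = c' * (e * st x * x * e) * c'.
  by rewrite !mulrA.
have -> : e * st x * x * e = e * (c * c).
  by rewrite cc mulrBr mulr1 eu /u opprB addrC subrK.
by rewrite mulrA -ec' -!mulrA (mulrA c') c'c mul1r cc' mulr1.
Qed.

End NearProjection.

Section FiniteRepresentative.
Context {R : realType} {A : cstarAlgType R}.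
Context (psi : A -> \bar R) (wpsi : weight psi) (dpsi : densely_defined psi).
Local Notation mxS := (mxstar (st := @ustar R A)).
Local Notation mxN := (mxnorm (N := @unorm R A)).

Definition mxinj m n (X : 'M[A]_(m, n)) : 'M[unitz A]_(m, n) := map_mx (@uinj R A) X.

Lemma mxinj_inj m n : injective (@mxinj m n).
Proof.
by move=> X Y /matrixP XY; apply/matrixP => i j; have := XY i j; rewrite !mxE => /uinj_inj.
Qed.

Lemma uinj_sum I (r : seq I) (F : I -> A) :
  uinj (\sum_(i <- r) F i) = \sum_(i <- r) uinj (F i).
Proof. exact: (big_morph (@uinj R A) (@uinjD R A)). Qed.

Lemma mxinjM m n p (X : 'M[A]_(m, n)) (Y : 'M[A]_(n, p)) :
  mxinj (mxcmul X Y) = mxinj X *m mxinj Y.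
Proof.
apply/matrixP => i j; rewrite !mxE uinj_sum.
by apply: eq_bigr => l _; rewrite !mxE uinjM.
Qed.

Lemma mxinj_star n (X : 'M[A]_n) : mxinj (mxcstar X) = mxS (mxinj X).
Proof. by apply/matrixP => i j; rewrite !mxE ustar_inj. Qed.

(** M_k(A) is an ideal in the matrices over the unitization. *)
Lemma mxinj_ideal n (X : 'M[A]_n) (Y : 'M[unitz A]_n) :
  exists Z, mxinj Z = mxinj X *m Y.
Proof.
exists (\matrix_(i, j) ((mxinj X *m Y) i j).1); apply/matrixP => i j.
rewrite 2!mxE; set z := (_ *m _) i j; suff z0 : z.2 = 0.
  by rewrite /uinj [RHS]surjective_pairing z0.
rewrite /z mxE; apply: (big_ind (fun y : unitz A => y.2 = 0)) => //.
  by move=> x y /= -> ->; rewrite addr0.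
by move=> l _; rewrite mxE umulE /= mul0r.
Qed.

(** An entry of e = e e^* is a sum of products y z^*. *)
Lemma approximable_proj k (e : 'M[A]_k) i j : mxproj e -> approximable psi (e i j).
Proof.
move=> /andP[/eqP ee /eqP es]; rewrite -{1}ee mxE; apply: approximable_sum => // l.
have -> : e l j = cstar (e j l) by rewrite -{1}es !mxE.
exact: approximable_mul.
Qed.

(** The entries of w are obtained from elements of finite weight by sums and
    right multiplications, so each diagonal entry of w w^* is a finite sum of
    elements of finite weight. *)
Lemma finite_representative k (e : 'M[A]_k) : mxproj e ->
  exists w : 'M[A]_k, [/\ mxcmul (mxcstar w) w = e, mxcmul w e = w &
    (weight_mx psi (mxcmul w (mxcstar w)) < +oo)%E].
Proof.
move=> ep; have /andP[/eqP ee /eqP es] := ep.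
have MB := matrix_banach_star_ring (unitz_cstar A) k.
pose E := mxinj e; have EE : E * E = E by rewrite /E -[LHS]mxinjM ee.
have sE : mxS E = E by rewrite /E -mxinj_star es.
pose m := mxN E; have m0 : 0 <= m := bnorm_ge0 MB E.
pose eta := (3 * m ^+ 2 + 4)^-1.
have eta0 : 0 < eta by rewrite invr_gt0; nra.
have etam : eta * (3 * m ^+ 2 + 4) = 1 by rewrite mulVf // gt_eqF //; nra.
have k0 : 0 < (k * k)%:R + 1 :> R by rewrite ltr_wpDl.
have /boolp.choice[x xP] (ij : 'I_k * 'I_k) : exists x, finite_weight psi x /\
    rnorm (e ij.1 ij.2 - x) <= eta / ((k * k)%:R + 1).
  have [x xf xe] := approximable_proj ij.1 ij.2 ep (divr_gt0 eta0 k0).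
  by exists x.
pose x' : 'M[A]_k := \matrix_(i, j) x (i, j).
pose X := mxinj x'; pose D := X - E.
have Dn : mxN D <= eta.
  rewrite -(bnormN MB) opprB.
  apply: (@le_trans _ _ ((k * k)%:R * (eta / ((k * k)%:R + 1)))).
    apply: mxnorm_le => i j; rewrite !mxE -[- uinj _]scaleN1r -uinjZ -uinjD scaleN1r.
    by apply: (le_trans (unorm_inj _)); have [_] := xP (i, j).
  by rewrite mulrA ler_pdivrMr // mulrC ler_wpM2l ?lerDl // ltW.
have sX : mxS (mxS X) = X by rewrite /X -!mxinj_star mxcstarK.
have [c' [Ec' XE]] := isometry_near_projection MB EE sE sX Dn.
have [g gE] := mxinj_ideal e c'.
exists (mxcmul x' g); split.
  apply: mxinj_inj; rewrite mxinjM mxinj_star mxinjM gE -/X -/E.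
  exact: XE.
  apply: mxinj_inj; rewrite !mxinjM gE -/X -/E.
  by rewrite -[_ *m c']/(E * c') -[LHS]/(X * (E * c') * E) -mulrA Ec' -(mulrA c') EE.
rewrite /weight_mx; apply: lte_sum_pinfty => i _.
rewrite mxE (eq_bigr (fun l => mulstar (mxcmul x' g i l))); last first.
  by move=> l _; rewrite !mxE.
rewrite weight_sum_mulstar //; apply: lte_sum_pinfty => l _.
rewrite mxE; apply: finite_weight_sum => // j; apply: finite_weightM => //.
by rewrite mxE; have [] := xP (i, j).
Qed.

End FiniteRepresentative.

(** * The lower weight on V(A) and on the Grothendieck group *)

Section LowerWeight.
Context {R : realType} {A : cstarAlgType R}.
Context (psi : A -> \bar R) (wpsi : weight psi) (dpsi : densely_defined psi).
Implicit Types e f g : Pinf A.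
Local Open Scope ereal_scope.

Lemma gram_diag m n (w : 'M[A]_(m, n)) i :
  mxcmul w (mxcstar w) i i = (\sum_l mulstar (w i l))%R.
Proof. by rewrite mxE; apply: eq_bigr => l _; rewrite !mxE. Qed.

Lemma positive_cone_gram_diag m n (w : 'M[A]_(m, n)) i :
  positive_cone (mxcmul w (mxcstar w) i i).
Proof. by rewrite gram_diag; exact: positive_cone_sum_mulstar. Qed.

Lemma weight_mx_gramD k m n (v : 'M[A]_(k, m)) (w : 'M[A]_(k, n)) :
  weight_mx psi (mxcmul v (mxcstar v) + mxcmul w (mxcstar w))%R =
  weight_mx psi (mxcmul v (mxcstar v)) + weight_mx psi (mxcmul w (mxcstar w)).
Proof.
rewrite /weight_mx -big_split; apply: eq_bigr => i _ /=.
by rewrite mxE (weightD wpsi) //; exact: positive_cone_gram_diag.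
Qed.

Lemma weight_inf_ge0 e : 0 <= weight_inf psi e.
Proof.
apply: sume_ge0 => i _; apply: (weight_ge0 wpsi).
have /andP[/eqP ee /eqP es] := pmxP e.
by rewrite -ee -[X in mxcmul _ X]es; exact: positive_cone_gram_diag.
Qed.

Lemma weight_inf_dsum e f : weight_inf psi (pdsum e f) = weight_inf psi e + weight_inf psi f.
Proof.
rewrite addeC /weight_inf /weight_mx /pdsum /pmx /= big_split_ord /=.
by congr (_ + _); apply: eq_bigr => i _; rewrite ?block_mxEul ?block_mxEdr.
Qed.

Lemma weight_lower_le e f : mvn f e -> weight_lower psi e <= weight_inf psi f.
Proof. by move=> fe; apply: ereal_inf_lbound; exists f. Qed.

Lemma weight_lower_ge0 e : 0 <= weight_lower psi e.
Proof. by apply: le_ereal_inf_tmp => _ [f _ <-]; exact: weight_inf_ge0. Qed.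

Lemma weight_lower_mvn e f : mvn e f -> weight_lower psi e = weight_lower psi f.
Proof.
move=> ef; congr (ereal_inf (image _ _)); apply/seteqP; split=> g /= ge.
  exact: mvn_trans ge ef.
exact: mvn_trans ge (mvn_sym ef).
Qed.

Lemma mxproj_gram m n (w : 'M[A]_(m, n)) :
  mxcmul w (mxcmul (mxcstar w) w) = w -> mxproj (mxcmul w (mxcstar w)).
Proof.
move=> we; apply/andP; split; apply/eqP; last by rewrite mxcstarM mxcstarK.
by rewrite mxcmulA -(mxcmulA w) we.
Qed.

Lemma mvn_gram e m (w : 'M[A]_(m, psize e)) (we : mxcmul (mxcstar w) w = pmx e)
  (p : mxproj (mxcmul w (mxcstar w))) : mvn (pinf p) e.
Proof. by apply/mvn_rect; exists w. Qed.

Lemma weight_lower_fin_num e : weight_lower psi e \is a fin_num.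
Proof.
rewrite ge0_fin_numE ?weight_lower_ge0 //.
have [w [ww we wf]] := finite_representative wpsi dpsi (pmxP e).
have p : mxproj (mxcmul w (mxcstar w)) by apply: mxproj_gram; rewrite ww.
exact: le_lt_trans (weight_lower_le (mvn_gram ww p)) wf.
Qed.

Lemma weight_lower_dsum_le e f :
  weight_lower psi (pdsum e f) <= weight_lower psi e + weight_lower psi f.
Proof.
apply/lee_addgt0Pr => d d0; have d20 : (0 < d / 2)%R by rewrite divr_gt0.
have [_ [e' e'e <-] he] := lb_ereal_inf_adherent d20 (weight_lower_fin_num e).
have [_ [f' f'f <-] hf] := lb_ereal_inf_adherent d20 (weight_lower_fin_num f).
apply: (le_trans (weight_lower_le (mvn_dsum e'e f'f))).
rewrite weight_inf_dsum [in leRHS](splitr d) EFinD addeACA.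
by apply: leeD; apply: ltW.
Qed.

(** Given w with w w^* = g and w^* w = f + e in block form, the columns of
    w (f + e) split g into orthogonal projections equivalent to f and to e. *)
Lemma weight_lower_dsum_ge e f :
  weight_lower psi e + weight_lower psi f <= weight_lower psi (pdsum e f).
Proof.
apply: le_ereal_inf_tmp => _ [g /mvn_rect[w [wg we]] <-].
have [/andP[/eqP gg /eqP gs] /andP[/eqP ee /eqP es] /andP[/eqP ff /eqP fs]] :=
  And3 (pmxP g) (pmxP e) (pmxP f).
pose v : 'M_(psize g, psize f + psize e) := w.
have vv : mxcmul (mxcstar v) v = block_mx (pmx f) 0%R 0%R (pmx e) by exact: we.
(* The factors pmx f and pmx e make vf pmx f = vf and ve pmx e = ve immediate,
   as mxproj_gram requires. *)
pose vf := mxcmul (lsubmx v) (pmx f); pose ve := mxcmul (rsubmx v) (pmx e).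
have vsE : mxcstar v = col_mx (mxcstar (lsubmx v)) (mxcstar (rsubmx v)).
  by rewrite -[RHS]mxcstarK mxcstar_col !mxcstarK hsubmxK.
have := vv; rewrite vsE -[X in mxcmul _ X]hsubmxK mxcmul_col_row.
move=> /eq_block_mx[lf _ _ re].
have gE : (mxcmul vf (mxcstar vf) + mxcmul ve (mxcstar ve))%R = pmx g.
  have -> : pmx g = mxcmul (mxcmul v (block_mx (pmx f) 0%R 0%R (pmx e))) (mxcstar v).
    by rewrite -vv !mxcmulA [mxcmul v _]wg -mxcmulA wg gg.
  rewrite -[X in mxcmul X (block_mx _ _ _ _)]hsubmxK mxcmul_row_col mxcmulDl vsE.
  rewrite -!mxcmulA !mxcmul_row_col !mxcmul0l addr0 add0r.
  rewrite /vf /ve !mxcstarM fs es.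
  by rewrite (mxcmulA (pmx f)) ff (mxcmulA (pmx e)) ee.
have vff : mxcmul (mxcstar vf) vf = pmx f.
  by rewrite mxcstarM fs mxcmulA -(mxcmulA (pmx f)) lf ff ff.
have vee : mxcmul (mxcstar ve) ve = pmx e.
  by rewrite mxcstarM es mxcmulA -(mxcmulA (pmx e)) re ee ee.
have pf : mxproj (mxcmul vf (mxcstar vf)).
  by apply: mxproj_gram; rewrite vff /vf -mxcmulA ff.
have pe : mxproj (mxcmul ve (mxcstar ve)).
  by apply: mxproj_gram; rewrite vee /ve -mxcmulA ee.
rewrite addeC /weight_inf -gE weight_mx_gramD; apply: leeD.
  exact: (weight_lower_le (mvn_gram vff pf)).
exact: (weight_lower_le (mvn_gram vee pe)).
Qed.

Lemma weight_lower_dsum e f :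
  weight_lower psi (pdsum e f) = weight_lower psi e + weight_lower psi f.
Proof. by apply/eqP; rewrite eq_le weight_lower_dsum_le weight_lower_dsum_ge. Qed.

Local Close Scope ereal_scope.

(** The passage to R through [fine] is faithful by [weight_lower_fin_num], and
    [repr] is harmless by [weight_lower_mvn]. *)
Definition Vweight (x : Vsemigroup A) : R := fine (weight_lower psi (repr x)).

Lemma Vweight_class e : (Vweight (Vclass e))%:E = weight_lower psi e.
Proof.
rewrite /Vweight fineK ?weight_lower_fin_num //; apply: weight_lower_mvn.
by apply/VclassP; rewrite /Vclass reprK.
Qed.

Lemma VweightD x y : Vweight (x + y) = Vweight x + Vweight y.
Proof.
have Vr (z : Vsemigroup A) : z = Vclass (repr z) by rewrite /Vclass reprK.
rewrite (Vr x) (Vr y) [Vclass _ + _]Vadd_class; apply: EFin_inj.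
by rewrite EFinD !Vweight_class weight_lower_dsum.
Qed.

Lemma Vweight0 : Vweight 0 = 0.
Proof. by apply: (addrI (Vweight 0)); rewrite -VweightD !addr0. Qed.

Definition K00weight (x : K00 A) : R := Vweight (repr x).1 - Vweight (repr x).2.

Lemma K00weight_gdiff (a b : Vsemigroup A) :
  K00weight (gdiff a b : K00 A) = Vweight a - Vweight b.
Proof.
rewrite /K00weight; set u := repr _.
have /gdiffP[c] := gdiff_repr (gdiff a b).
rewrite -/u => /(congr1 Vweight); rewrite !VweightD; lra.
Qed.

Lemma K00weight_is_additive : zmod_morphism K00weight.
Proof.
move=> x y; rewrite (gdiff_repr x) (gdiff_repr y).
rewrite [- gdiff _ _]goppE [gdiff _ _ + _]gaddE.
by rewrite !K00weight_gdiff !VweightD; lra.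
Qed.

End LowerWeight.

Theorem proposition3p6 (R : realType) (A : cstarAlgType R) (psi : A -> \bar R)
    (psi_weight : weight psi) (psi_dense : densely_defined psi) :
  exists psi_star : {additive K00 A -> R},
    forall e f : Pinf A,
      (psi_star (K00class e - K00class f))%:E =
      (weight_lower psi e - weight_lower psi f)%E.
Proof.
pose morph := GRing.isZmodMorphism.Build (K00 A) R (K00weight psi)
  (K00weight_is_additive psi_weight psi_dense).
pose psi_star : {additive K00 A -> R} := HB.pack (K00weight psi) morph.
have psi_starE e : (psi_star (K00class e))%:E = weight_lower psi e.
  rewrite [psi_star _](K00weight_gdiff psi_weight psi_dense).
  by rewrite (Vweight0 psi_weight psi_dense) subr0 Vweight_class.
by exists psi_star => e f; rewrite raddfB EFinB !psi_starE.
Qed.
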